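(* The classification of the grim reapers (with rulings parallel to $(0,1,0)$, up to translations in the $x$-direction) is the following: (1) Vertical planes (totally geodesic planes). (2) The horosphere $\mathsf{H}_1=\{z=1\}$. (3) A one-parameter family of entire graphs $\mathcal{G}(z_0)$, $z_0\in(0,1)$, over the $xy$-plane, that are periodic along the $x$-direction. The value $z_0$ is the Euclidean distance of $\mathcal{G}(z_0)$ to the plane $z=0$, i.e. the minimum of the $z$-coordinate on $\mathcal{G}(z_0)$. Moreover: (a) If $z_0\to 0$, then $\mathcal{G}(z_0)$ converges to a double covering of a vertical plane. (b) If $z_0\to 1$, then $\mathcal{G}(z_0)$ converges to the horosphere $\mathsf{H}_1$. (c) For each $z_0\in(0,1)$ there exists a unique $z_0^*\in(1,\infty)$ that is the Euclidean height of $\mathcal{G}(z_0)$ over $z=0$, i.e. the maximum of the $z$-coordinate on $\mathcal{G}(z_0)$. Hence $\mathcal{G}(z_0)$ can equivalently be parametrized in terms of $z_0^*$ (the correspondence $z_0\mapsto z_0^*$ is a bijection from $(0,1)$ onto $(1,\infty)$). In fact, if $z_0\to0$ (resp. $z_0\to1$) then $z_0^*\to\infty$ (resp. $z_0^*\to 1$).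
   Context: $\mathbb{H}^3$ is the upper half-space $\mathbb{R}^3_+=\{z>0\}$ with the metric $\langle\cdot,\cdot\rangle=\frac{1}{z^2}(dx^2+dy^2+dz^2)$. A horo-shrinker is an isometric immersion $\Psi:\Sigma\to\mathbb{H}^3$ of an oriented smooth surface whose mean curvature $H$ satisfies $H=\langle N,\partial_z\rangle$, where $N$ is the unit normal; $H$ is the average of the principal curvatures, with the sign convention that the horosphere $z=c$ with $N=c\,\partial_z$ has $H=1$ (equivalently $H=zH_e+(N^e)_3$ with $H_e$ the Euclidean mean curvature and $N^e=N/z$ the Euclidean unit normal). A one-parameter group of parabolic translations is $\{(x,y,z)\mapsto(x,y,z)+t(a,b,0):t\in\mathbb{R}\}$ with $(a,b)\neq(0,0)$. A grim reaper is a horo-shrinker invariant by a one-parameter group of parabolic translations; without loss of generality its rulings are parallel to $(0,1,0)$, so it is parametrized by $(s,t)\mapsto(x(s),t,z(s))$. With $s$ the hyperbolic arc-length of the generating curve $(x(s),0,z(s))$, being a horo-shrinker is equivalent to $$x'=z\cos\theta,\qquad z'=z\sin\theta,\qquad \theta'=2\cos\theta\,\frac{1-z}{z}$$ for some smooth function $\theta(s)$. $\mathcal{G}(z_0)$ denotes the grim reaper generated by the maximal solution of this system with $(x(0),z(0),\theta(0))=(0,z_0,0)$. Vertical means parallel to the $z$-axis. Surfaces in this classification are connected and maximal (generated by maximal solutions). Convergence of surfaces is convergence on compact subsets of $\mathbb{H}^3$ of the surfaces $\mathcal{G}(z_0)$ so normalized; ''double covering of a vertical plane'' means that the two branches of the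 generating curve on the two sides of its minimum point both converge to the same vertical line. *)

(* Defs.v *)
From Stdlib Require Import Reals.
From Coquelicot Require Export Coquelicot.
Open Scope R_scope.

Record vec3 := V3 { c1 : R; c2 : R; c3 : R }.

Definition vadd (u v : vec3) : vec3 :=
  V3 (c1 u + c1 v) (c2 u + c2 v) (c3 u + c3 v).
Definition vscal (a : R) (u : vec3) : vec3 :=
  V3 (a * c1 u) (a * c2 u) (a * c3 u).
Definition dot (u v : vec3) : R :=
  c1 u * c1 v + c2 u * c2 v + c3 u * c3 v.
Definition cross (u v : vec3) : vec3 :=
  V3 (c2 u * c3 v - c3 u * c2 v)
     (c3 u * c1 v - c1 u * c3 v)
     (c1 u * c2 v - c2 u * c1 v).
Definition edist (p q : vec3) : R :=
  let d := vadd p (vscal (-1) q) in sqrt (dot d d).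
Definition dz : vec3 := V3 0 0 1.

(** ** The half-space model: points [p] with [0 < c3 p] *)

Definition hmetric (p u v : vec3) : R := dot u v / (c3 p) ^ 2.

(* Christoffel part of the Levi-Civita connection at [p]: the metric is
   [exp (2 phi)] times the Euclidean one with [phi = - ln z], hence
   [nabla_u v = D_u v + (u phi) v + (v phi) u - (u . v) grad phi]. *)
Definition christoffel (p u v : vec3) : vec3 :=
  vscal (- / c3 p)
    (vadd (vadd (vscal (c3 u) v) (vscal (c3 v) u)) (vscal (- dot u v) dz)).

(** ** Parametrized surfaces *)

Definition psurf := R -> R -> vec3.

Definition du (X : psurf) : psurf := fun u v =>
  V3 (Derive (fun r => c1 (X r v)) u)
     (Derive (fun r => c2 (X r v)) u)
     (Derive (fun r => c3 (X r v)) u).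
Definition dv (X : psurf) : psurf := fun u v =>
  V3 (Derive (fun r => c1 (X u r)) v)
     (Derive (fun r => c2 (X u r)) v)
     (Derive (fun r => c3 (X u r)) v).

(* The unit normal of the orientation given by the parametrization. *)
Definition normal (X : psurf) : psurf := fun u v =>
  let n := cross (du X u v) (dv X u v) in
  vscal (c3 (X u v) / sqrt (dot n n)) n.

Definition I11 (X : psurf) u v := hmetric (X u v) (du X u v) (du X u v).
Definition I12 (X : psurf) u v := hmetric (X u v) (du X u v) (dv X u v).
Definition I22 (X : psurf) u v := hmetric (X u v) (dv X u v) (dv X u v).

Definition II11 (X : psurf) u v :=
  hmetric (X u v)
    (vadd (du (du X) u v) (christoffel (X u v) (du X u v) (du X u v)))
    (normal X u v).
Definition II12 (X : psurf) u v :=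
  hmetric (X u v)
    (vadd (du (dv X) u v) (christoffel (X u v) (du X u v) (dv X u v)))
    (normal X u v).
Definition II22 (X : psurf) u v :=
  hmetric (X u v)
    (vadd (dv (dv X) u v) (christoffel (X u v) (dv X u v) (dv X u v)))
    (normal X u v).

(* Half the trace of the shape operator, i.e. the average of the principal
   curvatures; horospheres [z = c] have mean curvature 1 for the upward
   normal. *)
Definition mean_curvature (X : psurf) u v :=
  (I22 X u v * II11 X u v - 2 * I12 X u v * II12 X u v
     + I11 X u v * II22 X u v)
  / (2 * (I11 X u v * I22 X u v - (I12 X u v) ^ 2)).

Definition immersed_at (X : psurf) u v :=
  0 < c3 (X u v) /\ 0 < I11 X u v * I22 X u v - (I12 X u v) ^ 2.

(* The equation is invariant under [N -> - N], so the choice of orientation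
   is irrelevant. *)
Definition horo_shrinker_at (X : psurf) u v :=
  immersed_at X u v /\
  mean_curvature X u v = hmetric (X u v) (normal X u v) dz.

Definition totally_geodesic_at (X : psurf) u v :=
  II11 X u v = 0 /\ II12 X u v = 0 /\ II22 X u v = 0.

(** ** Surfaces ruled in the direction (0,1,0) *)

(* A curve [s |-> (cx s, 0, cz s)] on the open interval (lo, hi); the values
   outside this interval are irrelevant. *)
Record curve := Curve { lo : Rbar; hi : Rbar; cx : R -> R; cz : R -> R }.

Definition dom (g : curve) (s : R) : Prop := Rbar_lt (lo g) s /\ Rbar_lt s (hi g).

Definition ruled (g : curve) : psurf := fun s t => V3 (cx g s) t (cz g s).

Definition surface (g : curve) (p : vec3) : Prop :=
  exists s t, dom g s /\ p = ruled g s t.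

Definition smooth_at (f : R -> R) (s : R) : Prop := forall n, ex_derive_n f n s.

Definition grim_reaper (g : curve) : Prop :=
  Rbar_lt (lo g) (hi g) /\
  forall s, dom g s ->
    smooth_at (cx g) s /\ smooth_at (cz g) s /\ 0 < cz g s /\
    ((Derive (cx g) s) ^ 2 + (Derive (cz g) s) ^ 2) / (cz g s) ^ 2 = 1 /\
    forall t, horo_shrinker_at (ruled g) s t.

Definition extends (g' g : curve) : Prop :=
  forall s, dom g s -> dom g' s /\ cx g' s = cx g s /\ cz g' s = cz g s.

Definition maximal_grim_reaper (g : curve) : Prop :=
  grim_reaper g /\
  forall g', grim_reaper g' -> extends g' g -> forall s, dom g' s -> dom g s.

(* [g] is [h] up to a translation in the x-direction and a change
   [s |-> s0 + s] or [s |-> s0 - s] of the arc-length parameter. *)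
Definition same_up_to_translation (g h : curve) : Prop :=
  exists a s0 e, (e = 1 \/ e = -1) /\
    forall s, (dom g s <-> dom h (s0 + e * s)) /\
      (dom g s -> cx g s = cx h (s0 + e * s) + a /\ cz g s = cz h (s0 + e * s)).

Definition vertical_plane (a : R) (p : vec3) : Prop := c1 p = a /\ 0 < c3 p.
Definition horosphere1 (p : vec3) : Prop := c3 p = 1.

Definition vertical_line : curve := Curve m_infty p_infty (fun _ => 0) exp.
Definition horizontal_line : curve :=
  Curve m_infty p_infty (fun s => s) (fun _ => 1).

(** ** The family G(z0) *)

Definition solution (g : curve) (theta : R -> R) : Prop :=
  forall s, dom g s ->
    0 < cz g s /\
    is_derive (cx g) s (cz g s * cos (theta s)) /\
    is_derive (cz g) s (cz g s * sin (theta s)) /\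
    is_derive theta s (2 * cos (theta s) * ((1 - cz g s) / cz g s)).

Definition solution_from (z0 : R) (g : curve) (theta : R -> R) : Prop :=
  solution g theta /\ dom g 0 /\ cx g 0 = 0 /\ cz g 0 = z0 /\ theta 0 = 0.

(* [g] is the generating curve given by the maximal solution, i.e. the one of
   which all solutions with the same initial data are restrictions. *)
Definition generates_G (z0 : R) (g : curve) : Prop :=
  exists theta, solution_from z0 g theta /\
    forall g' theta', solution_from z0 g' theta' ->
      extends g g' /\ forall s, dom g' s -> theta s = theta' s.

(* The entire surface is embedded and is the graph of [f (x, y) = u x]. *)
Definition entire_graph (g : curve) (u : R -> R) : Prop :=
  (forall x, smooth_at u x) /\
  (forall s1 s2, dom g s1 -> dom g s2 -> cx g s1 = cx g s2 -> s1 = s2) /\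
  forall p, surface g p <-> c3 p = u (c1 p).

Definition min_height (S : vec3 -> Prop) (h : R) : Prop :=
  (exists p, S p /\ c3 p = h) /\ forall p, S p -> h <= c3 p.
Definition max_height (S : vec3 -> Prop) (h : R) : Prop :=
  (exists p, S p /\ c3 p = h) /\ forall p, S p -> c3 p <= h.

(** ** Convergence on compact subsets *)

(* These sets are compact and every compact subset of the half-space is
   contained in one of them. *)
Definition box (r : R) (p : vec3) : Prop :=
  Rabs (c1 p) <= r /\ Rabs (c2 p) <= r /\ / r <= c3 p <= r.

Definition converges_on_compacts (F : (R -> Prop) -> Prop)
    (S : R -> vec3 -> Prop) (L : vec3 -> Prop) : Prop :=
  forall r eps, 0 < r -> 0 < eps -> F (fun a =>
    (forall p, box r p -> S a p -> exists q, L q /\ edist p q < eps) /\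
    (forall q, box r q -> L q -> exists p, S a p /\ edist p q < eps)).

(* The two pieces of the surface on either side of the ruling [s = 0]. *)
Definition right_branch (g : curve) (p : vec3) : Prop :=
  exists s t, dom g s /\ 0 <= s /\ p = ruled g s t.
Definition left_branch (g : curve) (p : vec3) : Prop :=
  exists s t, dom g s /\ s <= 0 /\ p = ruled g s t.

(* On every compact set, [S a] is eventually a single sheet over the planes
   orthogonal to the x-axis. *)
Definition single_sheeted (F : (R -> Prop) -> Prop) (S : R -> vec3 -> Prop) :=
  forall r, 0 < r -> F (fun a =>
    forall p q, box r p -> box r q -> S a p -> S a q ->
      c2 p = c2 q -> c3 p = c3 q -> p = q).

Definition converges_to_double_plane (F : (R -> Prop) -> Prop)
    (G : R -> curve) (a : R) : Prop :=
  (converges_on_compacts F (fun z0 => right_branch (G z0)) (vertical_plane a) /\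
   single_sheeted F (fun z0 => right_branch (G z0))) /\
  (converges_on_compacts F (fun z0 => left_branch (G z0)) (vertical_plane a) /\
   single_sheeted F (fun z0 => left_branch (G z0))).

(* Main.v *)
Require Import Defs.
From Stdlib Require Import Reals.
From Coquelicot Require Import Coquelicot.
From Stdlib Require Import Lra Lia Ranalysis5 ClassicalEpsilon.
Open Scope R_scope.

(** Let (c, sg) = (cos theta, sin theta) be the hyperbolic unit tangent of the
    generating curve.  For a ruled surface the horo-shrinker equation becomes the
    autonomous system
      x' = z c,  z' = z sg,  c' = - sg k,  sg' = c k,  k = 2 c (1 - z) / z
    ([grim_reaper_frame], [frame_grim_reaper]).  Written in 1/z, c and sg it is
    polynomial, so its solutions are unique ([frame_unique]); it is also invariant
    under time reversal, under x |-> - x and under translations in x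
    ([frame_symmetry]).

    Everything else follows from one first integral ([first_integral]): the
    quantity c exp (- 2 (1/z + log z)) is constant.  The function 1/z + log z
    decreases strictly on (0, 1) from infinity to 1 and increases strictly on
    (1, infinity) back to infinity.  An orbit with c = 0 is a vertical line, the
    equilibrium z = 1, sg = 0 is the horosphere, and every other orbit has, up to
    reversal, c > 0 and c = exp (2 (potential z - potential z0)) for exactly one z0
    in (0, 1).  As c <= 1, its height oscillates between z0 and the dual height
    above 1 with the same potential.  This gives the bijection between minimal and
    maximal heights and its limits.  It also gives the classification: the orbit of
    lowest height z0 passes through every state on its energy level
    ([profile_passes]), so uniqueness identifies it with any grim reaper in that state.

    A global solution starting at (0, z0, 0) is obtained by Picard iteration
    ([picard_lindelof]) for log z and theta, after the force has been frozen below
    the height z0, where the solution never goes ([clamped_solution_stays]).  The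
    angle vanishes again after a finite time ([profile_half_period]); reflecting
    the solution there and at s = 0 makes z periodic and x additive.  Since
    x' = z c is bounded below by a positive constant, the curve is an entire graph.

    For z0 -> 1 both extreme heights tend to 1.  For z0 -> 0 the first integral
    makes c tend to 0 uniformly on bounded ranges of heights bounded away from 0,
    so there the ascending arc is nearly vertical; near the minimum dx is at most
    d^2 d theta while z <= d <= 1/2.  Hence x tends to 0 on the part of the ascent
    inside a given compact set ([ascent_drift]).  The other arcs escape
    to infinity because turning back from angle 1 to angle 0 above height k costs a
    horizontal displacement of at least k/2 ([half_width_lower]). *)

(** * Monotonicity, constancy and uniqueness from derivatives *)

Lemma mean_value (f f' : R -> R) (a b : R) :
  a < b -> (forall s, a <= s <= b -> is_derive f s (f' s)) ->
  exists c, a < c < b /\ f b - f a = f' c * (b - a).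
Proof.
intros ab df.
destruct (MVT_cor2 f f' a b ab) as [c [e h]].
  intros s hs; apply is_derive_Reals, df, hs.
exists c; tauto.
Qed.

Lemma derive_nonneg_le (f f' : R -> R) (a b : R) :
  a <= b -> (forall s, a <= s <= b -> is_derive f s (f' s)) ->
  (forall s, a <= s <= b -> 0 <= f' s) -> f a <= f b.
Proof.
intros [ab | ->] df pos; [ | lra].
destruct (mean_value f f' a b ab df) as [c [hc e]].
assert (0 <= f' c * (b - a)) by (apply Rmult_le_pos; [apply pos | ]; lra).
lra.
Qed.

Lemma derive_pos_lt (f f' : R -> R) (a b : R) :
  a < b -> (forall s, a <= s <= b -> is_derive f s (f' s)) ->
  (forall s, a < s < b -> 0 < f' s) -> f a < f b.
Proof.
intros ab df pos.
destruct (mean_value f f' a b ab df) as [c [hc e]].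
assert (0 < f' c * (b - a)) by (apply Rmult_lt_0_compat; [apply pos | ]; lra).
lra.
Qed.

Lemma derive_zero_const (f : R -> R) (a b : R) :
  a <= b -> (forall s, a <= s <= b -> is_derive f s 0) -> f a = f b.
Proof.
intros [ab | ->] df; [ | reflexivity].
destruct (mean_value f (fun _ => 0) a b ab df) as [c [hc e]]; lra.
Qed.

(** D exp (- K s) is nonincreasing, nonnegative and starts at 0. *)
Lemma gronwall_zero (D D' : R -> R) (K a b : R) :
  a <= b -> (forall s, a <= s <= b -> is_derive D s (D' s)) ->
  (forall s, a <= s <= b -> 0 <= D s) ->
  (forall s, a <= s <= b -> D' s <= K * D s) ->
  D a = 0 -> D b = 0.
Proof.
intros ab dD pos le D0.
assert (h : - (D a * exp (- K * a)) <= - (D b * exp (- K * b))).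
  apply derive_nonneg_le with
    (f := fun s => - (D s * exp (- K * s)))
    (f' := fun s => (K * D s - D' s) * exp (- K * s)); [exact ab | | ].
  - intros s hs; specialize (dD s hs).
    evar_last.
      auto_derive; [exists (D' s); exact dD | reflexivity].
    replace (Derive (fun x => D x) s) with (D' s) by (symmetry; now apply is_derive_unique).
    simpl; ring.
  - intros s hs; apply Rmult_le_pos; [specialize (le s hs); lra | ].
    apply Rlt_le, exp_pos.
rewrite D0 in h.
assert (0 < exp (- K * b)) by apply exp_pos.
assert (0 <= D b) by (apply pos; lra).
nra.
Qed.

Lemma exp_le_exp (a b : R) : a <= b -> exp a <= exp b.
Proof.
intros [ab | ->]; [now apply Rlt_le, exp_increasing | apply Rle_refl].
Qed.

Lemma continuous_of_derive (f : R -> R) (s l : R) :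
  is_derive f s l -> continuous f s.
Proof.
intros df; apply (ex_derive_continuous (V := R_NormedModule)).
now exists l.
Qed.

Lemma ivt_segment (f : R -> R) (a b y : R) :
  a <= b -> (forall s, a <= s <= b -> continuous f s) ->
  f a <= y <= f b -> exists s, a <= s <= b /\ f s = y.
Proof.
intros ab cf [h1 h2].
destruct (Req_dec (f a) y) as [e | n1]; [exists a; split; [lra | exact e] | ].
destruct (Req_dec (f b) y) as [e | n2]; [exists b; split; [lra | exact e] | ].
destruct (IVT_interv (fun s => f s - y) a b) as [s [hs e]].
- intros s hs; apply continuity_pt_minus.
    apply continuity_pt_filterlim, cf, hs.
  apply continuity_pt_const; intros u v; reflexivity.
- destruct ab as [ab | ->]; lra.
- lra.
- lra.
- exists s; split; [exact hs | lra].
Qed.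

(** The supremum of the initial segments on which f stays positive is a zero. *)
Lemma first_zero (f : R -> R) (a b : R) :
  a <= b -> (forall s, a <= s <= b -> continuous f s) -> 0 < f a -> f b <= 0 ->
  exists m, a < m <= b /\ f m = 0 /\ forall s, a <= s < m -> 0 < f s.
Proof.
intros ab cf fa fb.
set (E s := a <= s <= b /\ forall t, a <= t <= s -> 0 < f t).
assert (Ea : E a) by (split; [lra | intros t ht; now replace t with a by lra]).
destruct (completeness E) as [m [ub lub]].
  exists b; intros s [hs _]; lra.
  now exists a.
assert (am : a <= m) by now apply ub.
assert (mb : m <= b) by (apply lub; intros s [hs _]; lra).
assert (pos : forall s, a <= s < m -> 0 < f s).
  intros s hs; destruct (Rlt_or_le 0 (f s)) as [p | n]; [exact p | exfalso].
  assert (m <= s); [ | lra].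
  apply lub; intros t [ht hpos].
  destruct (Rle_or_lt t s) as [l | l]; [exact l | ].
  specialize (hpos s); lra.
assert (near : 0 < Rabs (f m) -> exists d : posreal, forall t, Rabs (t - m) < d ->
   Rabs (f t - f m) < Rabs (f m)).
  intros p; destruct (proj1 (filterlim_locally _ _) (cf m (conj am mb)) (mkposreal _ p)) as [d hd].
  exists d; exact hd.
destruct (Rtotal_order (f m) 0) as [n | [z | p]].
- exfalso; destruct near as [d hd]; [rewrite Rabs_left; lra | ].
  destruct (Req_dec a m) as [-> | am']; [lra | ].
  set (t := Rmax a (m - d / 2)).
  pose proof (cond_pos d); pose proof (Rmax_l a (m - d / 2)); pose proof (Rmax_r a (m - d / 2)).
  assert (tm : t < m) by (apply Rmax_lub_lt; lra).
  specialize (pos t (conj H0 tm)).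
  specialize (hd t); rewrite Rabs_left in hd by lra; fold t in H0, H1.
  specialize (hd ltac:(lra)).
  rewrite (Rabs_left (f m)) in hd by lra.
  apply Rabs_def2 in hd; lra.
- exists m; split; [ | split; [exact z | exact pos]].
  split; [ | exact mb].
  destruct (Req_dec a m) as [-> | am']; lra.
- exfalso; destruct near as [d hd]; [rewrite Rabs_pos_eq; lra | ].
  set (t := Rmin b (m + d / 2)).
  pose proof (cond_pos d); pose proof (Rmin_l b (m + d / 2)); pose proof (Rmin_r b (m + d / 2)).
  assert (tm : m < t).
    apply Rmin_glb_lt; [ | lra].
    destruct (Req_dec m b) as [e | e]; [rewrite e in p | ]; lra.
  assert (t <= m); [ | lra].
  fold t in H0, H1.
  apply ub; split; [lra | intros r hr].
  destruct (Rlt_or_le r m) as [l | l]; [apply pos; lra | ].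
  specialize (hd r); rewrite Rabs_pos_eq in hd by lra.
  specialize (hd ltac:(lra)).
  rewrite (Rabs_pos_eq (f m)) in hd by lra.
  apply Rabs_def2 in hd; lra.
Qed.

(** A slope bounded below by k > 0 forces surjectivity onto R, and makes the
    inverse Lipschitz with constant 1/k.  The difference quotients of the inverse are
    then 1/f' at intermediate points which converge to the base point. *)
Lemma inverse_of_steep (f f' : R -> R) (k : R) :
  0 < k -> (forall s, is_derive f s (f' s)) -> (forall s, continuous f' s) ->
  (forall s, k <= f' s) ->
  exists g, (forall s, g (f s) = s) /\ (forall y, f (g y) = y) /\
    forall y, is_derive g y (/ f' (g y)).
Proof.
intros k0 df cf' lf.
assert (steep : forall a b, a <= b -> k * (b - a) <= f b - f a).
  intros a b ab.
  assert (h : f a - k * a <= f b - k * b).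
    apply (derive_nonneg_le (fun s => f s - k * s) (fun s => f' s - k)); [exact ab | | ].
    - intros s _; apply (is_derive_minus (V := R_NormedModule)); [apply df | ].
      auto_derive; [exact I | ring].
    - intros s _; specialize (lf s); lra.
  lra.
assert (steep' : forall a b, k * Rabs (b - a) <= Rabs (f b - f a)).
  intros a b; destruct (Rle_or_lt a b) as [l | l].
  - specialize (steep a b l); rewrite Rabs_pos_eq by lra.
    apply Rle_trans with (1 := steep), Rle_abs.
  - specialize (steep b a (Rlt_le _ _ l)).
    rewrite Rabs_minus_sym, (Rabs_minus_sym (f b)), Rabs_pos_eq by lra.
    apply Rle_trans with (1 := steep), Rle_abs.
assert (surj : forall y, exists s, f s = y).
  intros y; set (r := Rabs (y - f 0) / k).
  assert (r0 : 0 <= r).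
    apply Rmult_le_pos; [apply Rabs_pos | apply Rlt_le, Rinv_0_lt_compat, k0].
  assert (kr : k * r = Rabs (y - f 0)) by (unfold r; field; lra).
  destruct (ivt_segment f (- r) r y) as [s [_ e]]; [lra | | | now exists s].
  - intros s _; eapply continuous_of_derive, df.
  - pose proof (steep (- r) 0 ltac:(lra)) as h1; pose proof (steep 0 r r0) as h2.
    pose proof (Rle_abs (y - f 0)); pose proof (Rle_abs (- (y - f 0))).
    rewrite Rabs_Ropp in H0; lra.
set (g y := proj1_sig (constructive_indefinite_description _ (surj y))).
assert (fg : forall y, f (g y) = y).
  intros y; exact (proj2_sig (constructive_indefinite_description _ (surj y))).
exists g; split; [ | split; [exact fg | ]].
- intros s; specialize (steep' s (g (f s))).
  rewrite fg, Rminus_diag, Rabs_R0 in steep'.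
  apply Rminus_diag_uniq; destruct (Req_dec (g (f s) - s) 0) as [e | n]; [exact e | ].
  apply Rabs_pos_lt in n; nra.
- intros y.
  assert (cinv : continuous (fun s => / f' s) (g y)).
    apply (continuous_comp f' Rinv); [apply cf' | ].
    apply continuity_pt_filterlim, continuity_pt_inv; [ | specialize (lf (g y)); lra].
    apply continuity_pt_id.
  apply is_derive_Reals; intros eps eps0.
  destruct (proj1 (filterlim_locally _ _) cinv (mkposreal _ eps0)) as [d hd].
  assert (d0 : 0 < k * d) by (apply Rmult_lt_0_compat; [exact k0 | apply cond_pos]).
  exists (mkposreal _ d0); intros h h0 hh; simpl in hh.
  destruct (MVT_gen f (g y) (g (y + h)) f') as [c [hc e]].
  + intros s _; apply df.
  + intros s _; apply continuity_pt_filterlim; eapply continuous_of_derive, df.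
  + rewrite !fg in e; replace (y + h - y) with h in e by ring.
    pose proof (lf c) as lc.
    replace ((g (y + h) - g y) / h) with (/ f' c).
      apply (hd c).
      change (Rabs (c - g y) < d).
      apply Rmult_lt_reg_l with k; [exact k0 | ].
      apply Rle_lt_trans with (2 := hh).
      apply Rle_trans with (k * Rabs (g (y + h) - g y)).
        apply Rmult_le_compat_l; [lra | ].
        unfold Rmin, Rmax in hc; destruct Rle_dec; unfold Rabs; repeat destruct Rcase_abs; lra.
      pose proof (steep' (g y) (g (y + h))) as st; rewrite !fg in st.
      now replace (y + h - y) with h in st by ring.
    revert e; generalize (g (y + h) - g y); intros D e.
    rewrite e; field; split; [ | lra].
    intros e'; apply h0; rewrite e, e'; ring.
Qed.

(** * Global solutions of bounded Lipschitz systems in the plane *)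

Definition lipschitz2 (L : R) (F : R -> R -> R) :=
  forall a b a' b', Rabs (F a b - F a' b') <= L * (Rabs (a - a') + Rabs (b - b')).

Lemma lipschitz2_continuous (L : R) (F : R -> R -> R) (p q : R -> R) (s : R) :
  0 < L -> lipschitz2 L F -> continuous p s -> continuous q s ->
  continuous (fun t => F (p t) (q t)) s.
Proof.
intros L0 lF cp cq.
apply filterlim_locally; intros eps.
assert (e0 : 0 < eps / (2 * L)).
  apply Rdiv_lt_0_compat; [apply cond_pos | lra].
pose proof (proj1 (filterlim_locally _ _) cp (mkposreal _ e0)) as Hp.
pose proof (proj1 (filterlim_locally _ _) cq (mkposreal _ e0)) as Hq.
generalize (filter_and _ _ Hp Hq); apply filter_imp; intros t [hp hq].
change (Rabs (p t - p s) < eps / (2 * L)) in hp.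
change (Rabs (q t - q s) < eps / (2 * L)) in hq.
change (Rabs (F (p t) (q t) - F (p s) (q s)) < eps).
apply Rle_lt_trans with (1 := lF _ _ _ _).
apply Rlt_le_trans with (L * (eps / (2 * L) + eps / (2 * L))).
  apply Rmult_lt_compat_l; lra.
apply Req_le; field; lra.
Qed.

Lemma is_derive_primitive (f : R -> R) (a s : R) :
  (forall t, continuous f t) -> is_derive (fun s => RInt f a s) s (f s).
Proof.
intros cf; apply is_derive_RInt with a; [ | apply cf].
apply filter_forall; intros b; apply (RInt_correct (V := R_CompleteNormedModule)).
apply (ex_RInt_continuous (V := R_CompleteNormedModule)); intros; apply cf.
Qed.

Lemma derive_exp_bound_right (D d : R -> R) (A k : R) :
  0 < k -> D 0 = 0 -> (forall t, is_derive D t (d t)) ->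
  (forall t, Rabs (d t) <= A * exp (k * Rabs t)) ->
  forall s, 0 <= s -> Rabs (D s) <= A / k * exp (k * Rabs s).
Proof.
intros k0 D0 dD le s s0.
assert (A0 : 0 <= A).
  specialize (le 0); rewrite Rabs_R0, Rmult_0_r, exp_0 in le.
  pose proof (Rabs_pos (d 0)); lra.
assert (Ak : 0 <= A / k).
  apply Rmult_le_pos; [lra | ].
  apply Rlt_le, Rinv_0_lt_compat, k0.
assert (key : forall e, e = 1 \/ e = -1 -> e * D s <= A / k * exp (k * s)).
  intros e he.
  assert (h : A / k * exp (k * 0) - e * D 0 <= A / k * exp (k * s) - e * D s).
    apply (derive_nonneg_le (fun s => A / k * exp (k * s) - e * D s)
             (fun s => A * exp (k * s) - e * d s)); [exact s0 | | ].
    - intros t ht; evar_last.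
        auto_derive; [exists (d t); apply dD | reflexivity].
      replace (Derive (fun x => D x) t) with (d t) by (symmetry; now apply is_derive_unique).
      simpl; field; lra.
    - intros t ht; specialize (le t).
      rewrite (Rabs_pos_eq t) in le by lra.
      apply Rabs_le_between in le.
      destruct he; subst e; lra.
  rewrite D0, Rmult_0_r, exp_0 in h; lra.
rewrite (Rabs_pos_eq s s0).
pose proof (key 1 (or_introl eq_refl)); pose proof (key (-1) (or_intror eq_refl)).
apply Rabs_le; lra.
Qed.

(** Integrating a bound of order exp (k |t|) gains a factor 1/k.  This
    is what makes the Picard map a contraction for a weighted sup norm on the whole
    line, without any restriction to short times. *)
Lemma derive_exp_bound (D d : R -> R) (A k : R) :
  0 < k -> D 0 = 0 -> (forall t, is_derive D t (d t)) ->
  (forall t, Rabs (d t) <= A * exp (k * Rabs t)) ->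
  forall s, Rabs (D s) <= A / k * exp (k * Rabs s).
Proof.
intros k0 D0 dD le s.
destruct (Rle_or_lt 0 s) as [s0 | s0].
  now apply derive_exp_bound_right with d.
assert (h := derive_exp_bound_right (fun t => D (- t)) (fun t => - d (- t)) A k k0).
rewrite <- (Rabs_Ropp s).
replace (D s) with (D (- - s)) by (f_equal; ring).
apply h; [now rewrite Ropp_0 | | | lra].
- intros t; evar_last.
    apply (is_derive_comp D (fun t => - t)); [apply dD | ].
    auto_derive; [exact I | reflexivity].
  unfold scal; simpl; unfold mult; simpl; ring.
- intros t; rewrite Rabs_Ropp, <- (Rabs_Ropp t); apply le.
Qed.

Lemma geometric_limit (u : nat -> R) (A : R) :
  (forall n, Rabs (u (S n) - u n) <= A * (1 / 2) ^ n) ->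
  exists l : R, is_lim_seq u l /\ forall n, Rabs (l - u n) <= 2 * A * (1 / 2) ^ n.
Proof.
intros hu.
assert (A0 : 0 <= A).
  specialize (hu O); simpl in hu; pose proof (Rabs_pos (u 1%nat - u O)); lra.
assert (tail : forall n k, Rabs (u (n + k)%nat - u n) <= 2 * A * (1 / 2) ^ n).
  intros n k.
  apply Rle_trans with (2 * A * (1 / 2) ^ n * (1 - (1 / 2) ^ k)).
  - induction k as [ | k IH].
      rewrite Nat.add_0_r, Rminus_diag, Rabs_R0; simpl; lra.
    rewrite Nat.add_succ_r.
    replace (u (S (n + k)) - u n)
      with ((u (S (n + k)) - u (n + k)%nat) + (u (n + k)%nat - u n)) by ring.
    apply Rle_trans with (1 := Rabs_triang _ _).
    specialize (hu (n + k)%nat); rewrite pow_add in hu.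
    simpl pow; lra.
  - assert (0 < (1 / 2) ^ k) by (apply pow_lt; lra).
    assert (0 < (1 / 2) ^ n) by (apply pow_lt; lra).
    assert (0 <= A * (1 / 2) ^ n) by (apply Rmult_le_pos; lra).
    nra.
assert (small : is_lim_seq (fun n => 2 * (2 * A * (1 / 2) ^ n)) 0).
  evar_last.
    apply is_lim_seq_scal_l, is_lim_seq_scal_l, is_lim_seq_geom.
    rewrite Rabs_pos_eq; lra.
  simpl; f_equal; ring.
assert (cau : ex_lim_seq_cauchy u).
  intros eps.
  apply is_lim_seq_spec in small; destruct (small eps) as [N hN].
  exists N; intros n m hn hm.
  specialize (hN N (Nat.le_refl N)).
  apply Rabs_def2 in hN.
  replace (u n - u m) with ((u n - u N) - (u m - u N)) by ring.
  apply Rle_lt_trans with (1 := Rabs_triang _ _); rewrite Rabs_Ropp.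
  pose proof (tail N (n - N)%nat) as t1; pose proof (tail N (m - N)%nat) as t2.
  replace (N + (n - N))%nat with n in t1 by lia.
  replace (N + (m - N))%nat with m in t2 by lia.
  lra.
apply ex_lim_seq_cauchy_corr in cau; destruct cau as [l hl].
exists l; split; [exact hl | intros n].
assert (h : Rbar_le (Rabs (l - u n)) (2 * A * (1 / 2) ^ n)).
  apply is_lim_seq_le with (fun k => Rabs (u (k + n)%nat - u n))
    (fun _ : nat => 2 * A * (1 / 2) ^ n).
  - intros k; rewrite Nat.add_comm; apply tail.
  - apply (is_lim_seq_abs _ (l - u n)).
    apply (is_lim_seq_minus' _ (fun _ => u n)); [ | apply is_lim_seq_const].
    now apply (is_lim_seq_incr_n u n).
  - apply is_lim_seq_const.
exact h.
Qed.

Fixpoint picard (F1 F2 : R -> R -> R) (p0 q0 : R) (n : nat) : (R -> R) * (R -> R) :=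
  match n with
  | O => (fun _ => p0, fun _ => q0)
  | S n => let (p, q) := picard F1 F2 p0 q0 n in
           (fun s => p0 + RInt (fun t => F1 (p t) (q t)) 0 s,
            fun s => q0 + RInt (fun t => F2 (p t) (q t)) 0 s)
  end.

Lemma is_derive_plus_primitive (y0 : R) (f : R -> R) :
  (forall t, continuous f t) ->
  forall s, is_derive (fun s => y0 + RInt f 0 s) s (f s).
Proof.
intros cf s; evar_last.
  apply @is_derive_plus; [apply @is_derive_const | now apply is_derive_primitive].
apply plus_zero_l.
Qed.

(** With the weight exp (- 4 L |s|) each Picard step halves the distance
    between consecutive iterates, so they converge pointwise at a geometric rate.  The
    bound M makes all iterates M-Lipschitz, which gives continuity of the limit, and
    the integral equation passes to the limit by the same weighted estimate. *)
Theorem picard_lindelof (F1 F2 : R -> R -> R) (L M p0 q0 : R) :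
  0 < L -> lipschitz2 L F1 -> lipschitz2 L F2 ->
  (forall a b, Rabs (F1 a b) <= M) -> (forall a b, Rabs (F2 a b) <= M) ->
  exists p q : R -> R, p 0 = p0 /\ q 0 = q0 /\
    forall s, is_derive p s (F1 (p s) (q s)) /\ is_derive q s (F2 (p s) (q s)).
Proof.
intros L0 l1 l2 b1 b2.
assert (M0 : 0 <= M) by (pose proof (b1 0 0); pose proof (Rabs_pos (F1 0 0)); lra).
set (P n := fst (picard F1 F2 p0 q0 n)); set (Q n := snd (picard F1 F2 p0 q0 n)).
assert (PS : forall n s, P (S n) s = p0 + RInt (fun t => F1 (P n t) (Q n t)) 0 s).
  intros n s; unfold P, Q; simpl; now destruct (picard F1 F2 p0 q0 n).
assert (QS : forall n s, Q (S n) s = q0 + RInt (fun t => F2 (P n t) (Q n t)) 0 s).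
  intros n s; unfold P, Q; simpl; now destruct (picard F1 F2 p0 q0 n).
assert (PO : P 0%nat = fun _ => p0) by reflexivity.
assert (QO : Q 0%nat = fun _ => q0) by reflexivity.
clearbody P Q.
assert (cont : forall n s, continuous (P n) s /\ continuous (Q n) s).
  induction n as [ | n IH]; intros s.
    rewrite PO, QO; split; apply continuous_const.
  split.
  - apply continuous_ext with (1 := fun s => eq_sym (PS n s)).
    eapply continuous_of_derive, (is_derive_plus_primitive p0 (fun t => F1 (P n t) (Q n t))).
    intros t; apply (lipschitz2_continuous L F1 (P n) (Q n) t L0 l1); apply IH.
  - apply continuous_ext with (1 := fun s => eq_sym (QS n s)).
    eapply continuous_of_derive, (is_derive_plus_primitive q0 (fun t => F2 (P n t) (Q n t))).
    intros t; apply (lipschitz2_continuous L F2 (P n) (Q n) t L0 l2); apply IH.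
assert (dP : forall n s, is_derive (P (S n)) s (F1 (P n s) (Q n s))).
  intros n s; apply is_derive_ext with (1 := fun s => eq_sym (PS n s)).
  apply (is_derive_plus_primitive p0 (fun t => F1 (P n t) (Q n t))).
  intros t; apply (lipschitz2_continuous L F1 (P n) (Q n) t L0 l1); apply cont.
assert (dQ : forall n s, is_derive (Q (S n)) s (F2 (P n s) (Q n s))).
  intros n s; apply is_derive_ext with (1 := fun s => eq_sym (QS n s)).
  apply (is_derive_plus_primitive q0 (fun t => F2 (P n t) (Q n t))).
  intros t; apply (lipschitz2_continuous L F2 (P n) (Q n) t L0 l2); apply cont.
assert (P00 : forall n, P n 0 = p0).
  intros [ | n]; [now rewrite PO | rewrite PS, RInt_point; apply Rplus_0_r].
assert (Q00 : forall n, Q n 0 = q0).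
  intros [ | n]; [now rewrite QO | rewrite QS, RInt_point; apply Rplus_0_r].
assert (dP0 : forall t, is_derive (P 0%nat) t 0).
  intros t; rewrite PO; exact (is_derive_const (V := R_NormedModule) p0 t).
assert (dQ0 : forall t, is_derive (Q 0%nat) t 0).
  intros t; rewrite QO; exact (is_derive_const (V := R_NormedModule) q0 t).
set (k := 4 * L).
assert (k0 : 0 < k) by (unfold k; lra).
assert (step : forall n s,
  Rabs (P (S n) s - P n s) <= M / k * (1 / 2) ^ n * exp (k * Rabs s) /\
  Rabs (Q (S n) s - Q n s) <= M / k * (1 / 2) ^ n * exp (k * Rabs s)).
  induction n as [ | n IH]; intros s.
  - assert (e1 : forall t, 1 <= exp (k * Rabs t)).
      intros t; rewrite <- exp_0; apply exp_le_exp.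
      apply Rmult_le_pos; [lra | apply Rabs_pos].
    rewrite Rmult_1_r; split.
    + apply (derive_exp_bound (fun s => P 1%nat s - P 0%nat s)
               (fun s => F1 (P 0%nat s) (Q 0%nat s) - 0)); [exact k0 | | | ].
      * rewrite !P00; ring.
      * intros t; apply (is_derive_minus (V := R_NormedModule)); [apply dP | apply dP0].
      * intros t; rewrite Rminus_0_r; specialize (e1 t).
        pose proof (b1 (P 0%nat t) (Q 0%nat t)); nra.
    + apply (derive_exp_bound (fun s => Q 1%nat s - Q 0%nat s)
               (fun s => F2 (P 0%nat s) (Q 0%nat s) - 0)); [exact k0 | | | ].
      * rewrite !Q00; ring.
      * intros t; apply (is_derive_minus (V := R_NormedModule)); [apply dQ | apply dQ0].
      * intros t; rewrite Rminus_0_r; specialize (e1 t).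
        pose proof (b2 (P 0%nat t) (Q 0%nat t)); nra.
  - assert (e : M / k * (1 / 2) ^ S n = (L * (2 * (M / k * (1 / 2) ^ n))) / k).
      unfold k; simpl; field; lra.
    rewrite e; split.
    + apply (derive_exp_bound (fun s => P (S (S n)) s - P (S n) s)
               (fun s => F1 (P (S n) s) (Q (S n) s) - F1 (P n s) (Q n s))); [exact k0 | | | ].
      * rewrite !P00; ring.
      * intros t; apply (is_derive_minus (V := R_NormedModule)); apply dP.
      * intros t; apply Rle_trans with (1 := l1 _ _ _ _).
        rewrite Rmult_assoc; apply Rmult_le_compat_l; [lra | ].
        destruct (IH t); lra.
    + apply (derive_exp_bound (fun s => Q (S (S n)) s - Q (S n) s)
               (fun s => F2 (P (S n) s) (Q (S n) s) - F2 (P n s) (Q n s))); [exact k0 | | | ].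
      * rewrite !Q00; ring.
      * intros t; apply (is_derive_minus (V := R_NormedModule)); apply dQ.
      * intros t; apply Rle_trans with (1 := l2 _ _ _ _).
        rewrite Rmult_assoc; apply Rmult_le_compat_l; [lra | ].
        destruct (IH t); lra.
set (p s := real (Lim_seq (fun n => P n s))); set (q s := real (Lim_seq (fun n => Q n s))).
assert (lim : forall U : nat -> R -> R,
  (forall n s, Rabs (U (S n) s - U n s) <= M / k * (1 / 2) ^ n * exp (k * Rabs s)) ->
  forall s, is_lim_seq (fun n => U n s) (real (Lim_seq (fun n => U n s))) /\
   forall n, Rabs (real (Lim_seq (fun n => U n s)) - U n s)
               <= 2 * (M / k * exp (k * Rabs s)) * (1 / 2) ^ n).
  intros U hU s.
  destruct (geometric_limit (fun n => U n s) (M / k * exp (k * Rabs s))) as [l [h1 h2]].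
    intros n; specialize (hU n s); simpl in hU |- *; lra.
  rewrite (is_lim_seq_unique _ _ h1); split; assumption.
assert (limP : forall s, is_lim_seq (fun n => P n s) (p s) /\
  forall n, Rabs (p s - P n s) <= 2 * (M / k * exp (k * Rabs s)) * (1 / 2) ^ n).
  exact (lim P (fun n s => proj1 (step n s))).
assert (limQ : forall s, is_lim_seq (fun n => Q n s) (q s) /\
  forall n, Rabs (q s - Q n s) <= 2 * (M / k * exp (k * Rabs s)) * (1 / 2) ^ n).
  exact (lim Q (fun n s => proj2 (step n s))).
clear lim.
(* The limits are continuous because every iterate is Lipschitz with constant M. *)
assert (lip : forall U : nat -> R -> R,
  (forall n s, exists d, is_derive (U (S n)) s d /\ Rabs d <= M) ->
  forall (l : R -> R) (s : R), (forall s, is_lim_seq (fun n => U n s) (l s)) -> continuous l s).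
  intros U hU l s hl.
  assert (lipU : forall n a b, Rabs (U (S n) a - U (S n) b) <= M * Rabs (a - b)).
    intros n a b.
    destruct (MVT_gen (U (S n)) b a (Derive (U (S n)))) as [c [_ ec]].
    - intros t _; destruct (hU n t) as [d [h _]]; apply Derive_correct; now exists d.
    - intros t _; destruct (hU n t) as [d [h _]].
      apply continuity_pt_filterlim; eapply continuous_of_derive; exact h.
    - rewrite ec, Rabs_mult; apply Rmult_le_compat_r; [apply Rabs_pos | ].
      destruct (hU n c) as [d [h b']]; now rewrite (is_derive_unique _ _ _ h).
  assert (lipl : forall a b, Rabs (l a - l b) <= M * Rabs (a - b)).
    intros a b.
    assert (h : Rbar_le (Rabs (l a - l b)) (M * Rabs (a - b))).
      apply is_lim_seq_le with (fun n => Rabs (U (S n) a - U (S n) b))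
        (fun _ : nat => M * Rabs (a - b)); [intros n; apply lipU | | apply is_lim_seq_const].
      apply (is_lim_seq_abs _ (l a - l b)).
      apply (is_lim_seq_incr_1 (fun n => U n a - U n b)).
      now apply is_lim_seq_minus'.
    exact h.
  apply filterlim_locally; intros eps.
  assert (e0 : 0 < eps / (M + 1)) by (apply Rdiv_lt_0_compat; [apply cond_pos | lra]).
  exists (mkposreal _ e0); intros t ht.
  change (Rabs (t - s) < eps / (M + 1)) in ht.
  change (Rabs (l t - l s) < eps).
  apply Rle_lt_trans with (1 := lipl t s).
  apply Rle_lt_trans with ((M + 1) * Rabs (t - s)).
    pose proof (Rabs_pos (t - s)); nra.
  replace (pos eps) with ((M + 1) * (eps / (M + 1))) by (field; lra).
  apply Rmult_lt_compat_l; lra.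
assert (cp : forall s, continuous p s).
  intros s; apply (lip P); [ | intros; apply limP].
  intros n t; eexists; split; [apply dP | apply b1].
assert (cq : forall s, continuous q s).
  intros s; apply (lip Q); [ | intros; apply limQ].
  intros n t; eexists; split; [apply dQ | apply b2].
clear lip.
assert (fix_ : forall (F : R -> R -> R) (U : nat -> R -> R) (u : R -> R) (y0 : R),
  lipschitz2 L F -> (forall n s, is_derive (U (S n)) s (F (P n s) (Q n s))) ->
  (forall n, U n 0 = y0) ->
  (forall s, is_lim_seq (fun n => U n s) (u s)) ->
  u 0 = y0 /\ forall s, is_derive u s (F (p s) (q s))).
  intros F U u y0 lF dU U0 limU.
  assert (cF : forall t, continuous (fun t => F (p t) (q t)) t).
    intros t; apply lipschitz2_continuous with L; [exact L0 | exact lF | apply cp | apply cq].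
  assert (eq : forall s, u s = y0 + RInt (fun t => F (p t) (q t)) 0 s).
    intros s.
    set (y := y0 + RInt (fun t => F (p t) (q t)) 0 s).
    assert (est : forall n, Rabs (y - U (S n) s)
                    <= L * (4 * (M / k) * (1 / 2) ^ n) / k * exp (k * Rabs s)).
      intros n.
      apply (derive_exp_bound
        (fun s => (y0 + RInt (fun t => F (p t) (q t)) 0 s) - U (S n) s)
        (fun s => F (p s) (q s) - F (P n s) (Q n s))); [exact k0 | | | ].
      - rewrite RInt_point, U0; unfold zero; simpl; ring.
      - intros t; apply (is_derive_minus (V := R_NormedModule)); [ | apply dU].
        now apply (is_derive_plus_primitive y0 (fun t => F (p t) (q t))).
      - intros t; apply Rle_trans with (1 := lF _ _ _ _).
        rewrite Rmult_assoc; apply Rmult_le_compat_l; [lra | ].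
        pose proof (proj2 (limP t) n); pose proof (proj2 (limQ t) n); lra.
    assert (limy : is_lim_seq (fun n => U n s) y).
      apply is_lim_seq_incr_1.
      apply is_lim_seq_ext with (fun n => y - (y - U (S n) s)); [intros n; ring | ].
      replace (Finite y) with (Finite (y - 0)) by (f_equal; ring).
      apply is_lim_seq_minus'; [apply is_lim_seq_const | ].
      apply is_lim_seq_abs_0.
      apply is_lim_seq_le_le with (fun _ => 0)
        (fun n => L * (4 * (M / k)) / k * exp (k * Rabs s) * (1 / 2) ^ n).
      - intros n; split; [apply Rabs_pos | ].
        eapply Rle_trans; [apply est | apply Req_le; field; lra].
      - apply is_lim_seq_const.
      - evar_last; [apply is_lim_seq_scal_l, is_lim_seq_geom; rewrite Rabs_pos_eq; lra | ].
        simpl; f_equal; ring.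
    generalize (is_lim_seq_unique _ _ (limU s)), (is_lim_seq_unique _ _ limy).
    intros -> e; now injection e.
  split.
  - rewrite eq, RInt_point; apply Rplus_0_r.
  - intros s; apply is_derive_ext with (1 := fun s => eq_sym (eq s)).
    now apply (is_derive_plus_primitive y0 (fun t => F (p t) (q t))).
destruct (fix_ F1 P p p0 l1 dP P00 (fun s => proj1 (limP s))) as [p00 dp].
destruct (fix_ F2 Q q q0 l2 dQ Q00 (fun s => proj1 (limQ s))) as [q00 dq].
exists p, q; split; [exact p00 | split; [exact q00 | ]].
intros s; split; [apply dp | apply dq].
Qed.

(** * The potential 1/z + log z *)

(** Half the logarithm of the cosine of the angle varies along a solution like
    this function of the height. *)
Definition potential (z : R) : R := / z + ln z.

Lemma potential_derive (z : R) :
  0 < z -> is_derive potential z ((z - 1) / z ^ 2).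
Proof.
intros z0; unfold potential; auto_derive; [lra | field; lra].
Qed.

Lemma potential_continuous (z : R) : 0 < z -> continuous potential z.
Proof. intros z0; eapply continuous_of_derive, potential_derive, z0. Qed.

Lemma potential_1 : potential 1 = 1.
Proof. unfold potential; rewrite ln_1; field. Qed.

Lemma potential_decreasing (a b : R) : 0 < a -> a < b -> b <= 1 -> potential b < potential a.
Proof.
intros a0 ab b1.
apply Ropp_lt_cancel.
apply (derive_pos_lt (fun z => - potential z) (fun z => (1 - z) / z ^ 2)); [exact ab | | ].
- intros z hz; evar_last.
    apply @is_derive_opp, potential_derive; lra.
  unfold opp; simpl; field; lra.
- intros z hz; apply Rdiv_lt_0_compat; [lra | apply pow_lt; lra].
Qed.

Lemma potential_increasing (a b : R) : 1 <= a -> a < b -> potential a < potential b.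
Proof.
intros a1 ab.
apply (derive_pos_lt potential (fun z => (z - 1) / z ^ 2)); [exact ab | | ].
- intros z hz; apply potential_derive; lra.
- intros z hz; apply Rdiv_lt_0_compat; [lra | apply pow_lt; lra].
Qed.

Lemma potential_gt_1 (z : R) : 0 < z -> z <> 1 -> 1 < potential z.
Proof.
intros z0 z1; rewrite <- potential_1.
destruct (Rlt_or_le z 1); [apply potential_decreasing | apply potential_increasing]; lra.
Qed.

(** Only the blow-up at 0 matters; log z is absorbed by half of 1/z. *)
Lemma potential_lower (z : R) : 0 < z -> / (2 * z) <= potential z.
Proof.
intros z0; unfold potential.
(* This is [exp y >= 1 + y] at [y = - ln z - ln 2]. *)
assert (h : ln (/ (2 * z)) <= / (2 * z) - 1).
  assert (v0 : 0 < / (2 * z)) by (apply Rinv_0_lt_compat; lra).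
  pose proof (exp_ineq1_le (ln (/ (2 * z)))) as h.
  rewrite (exp_ln _ v0) in h; lra.
rewrite ln_Rinv, ln_mult in h by lra.
assert (l2 := ln_lt_2).
assert (l1 : ln 2 <= 1).
  rewrite <- (ln_exp 1); apply Rlt_le, ln_increasing; [lra | ].
  pose proof (exp_ineq1 1); lra.
replace (/ z) with (/ (2 * z) + / (2 * z)) by (field; lra).
lra.
Qed.

Lemma potential_onto_low (E : R) : 1 < E -> exists z, 0 < z < 1 /\ potential z = E.
Proof.
intros E1.
assert (v0 : 0 < / (2 * E)) by (apply Rinv_0_lt_compat; lra).
assert (v1 : / (2 * E) < 1) by (rewrite <- Rinv_1; apply Rinv_lt_contravar; lra).
destruct (ivt_segment (fun z => - potential z) (/ (2 * E)) 1 (- E)) as [z [hz e]].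
- lra.
- intros z hz; apply (continuous_opp (V := R_NormedModule)), potential_continuous; lra.
- rewrite potential_1; split; [ | lra].
  pose proof (potential_lower _ v0) as h.
  replace (/ (2 * / (2 * E))) with E in h by (field; lra).
  lra.
- exists z; split; [ | lra].
  split; [lra | ].
  destruct (Req_dec z 1) as [-> | n]; [rewrite potential_1 in e | ]; lra.
Qed.

Lemma potential_onto_high (E : R) : 1 < E -> exists z, 1 < z /\ potential z = E.
Proof.
intros E1.
assert (l1 : 1 < exp E) by (pose proof (exp_ineq1 E); lra).
destruct (ivt_segment potential 1 (exp E) E) as [z [hz e]].
- lra.
- intros z hz; apply potential_continuous; lra.
- rewrite potential_1; split; [lra | ].
  unfold potential; rewrite ln_exp.
  pose proof (Rinv_0_lt_compat _ (exp_pos E)); lra.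
- exists z; split; [ | exact e].
  destruct (Req_dec z 1) as [-> | n]; [rewrite potential_1 in e | ]; lra.
Qed.

Lemma potential_inj_low (a b : R) :
  0 < a <= 1 -> 0 < b <= 1 -> potential a = potential b -> a = b.
Proof.
intros ha hb e; destruct (Rtotal_order a b) as [l | [l | l]]; [ | exact l | ].
- pose proof (potential_decreasing a b); lra.
- pose proof (potential_decreasing b a); lra.
Qed.

Lemma potential_inj_high (a b : R) :
  1 <= a -> 1 <= b -> potential a = potential b -> a = b.
Proof.
intros ha hb e; destruct (Rtotal_order a b) as [l | [l | l]]; [ | exact l | ].
- pose proof (potential_increasing a b); lra.
- pose proof (potential_increasing b a); lra.
Qed.

Lemma potential_min (z : R) : 0 < z -> 1 <= potential z.
Proof.
intros z0; destruct (Req_dec z 1) as [-> | n]; [rewrite potential_1; lra | ].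
now apply Rlt_le, potential_gt_1.
Qed.

(** * The equations of motion of the unit tangent *)

(** The right-hand side of the equation for the angle, expressed by c = cos theta.
    Working with (c, sg) instead of theta avoids lifting the tangent of an arbitrary
    grim reaper to an angle. *)
Definition turning (z c : R) : R := 2 * c * ((1 - z) / z).

Definition frame_at (x z c sg : R -> R) (s : R) : Prop :=
  0 < z s /\ c s ^ 2 + sg s ^ 2 = 1 /\
  is_derive x s (z s * c s) /\
  is_derive z s (z s * sg s) /\
  is_derive c s (- (sg s * turning (z s) (c s))) /\
  is_derive sg s (c s * turning (z s) (c s)).

Lemma is_derive_affine (f : R -> R) (l m e s0 s : R) :
  is_derive f (s0 + e * s) l -> m = e * l -> is_derive (fun s => f (s0 + e * s)) s m.
Proof.
intros df ->; evar_last.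
  apply (is_derive_comp f (fun s => s0 + e * s)); [exact df | ].
  auto_derive; [exact I | reflexivity].
unfold scal; simpl; unfold mult; simpl; ring.
Qed.

Lemma is_derive_scal_plus (f : R -> R) (l m a k s : R) :
  is_derive f s l -> m = k * l -> is_derive (fun s => k * f s + a) s m.
Proof.
intros df ->; evar_last.
  apply (is_derive_plus (V := R_NormedModule)).
    apply (is_derive_scal f s k l df).
  apply @is_derive_const.
unfold plus, zero; simpl; ring.
Qed.

(** The factor e reverses time and d reflects in a vertical plane.  With
    d = e the two effects on x cancel: the curve is only reparametrized. *)
Lemma frame_symmetry (x z c sg : R -> R) (a d e s0 s : R) :
  d = 1 \/ d = -1 -> e = 1 \/ e = -1 -> frame_at x z c sg (s0 + e * s) ->
  frame_at (fun s => (d * e) * x (s0 + e * s) + a) (fun s => z (s0 + e * s))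
    (fun s => d * c (s0 + e * s) + 0) (fun s => e * sg (s0 + e * s) + 0) s.
Proof.
intros hd he [z0 [u [dx [dz_ [dc ds]]]]].
assert (dd : d * d = 1) by (destruct hd; subst d; ring).
assert (ee : e * e = 1) by (destruct he; subst e; ring).
unfold frame_at, turning in *.
split; [exact z0 | split].
  rewrite !Rplus_0_r, !Rpow_mult_distr, <- u; simpl; rewrite !Rmult_1_r, dd, ee; ring.
split; [ | split; [ | split]].
- eapply is_derive_scal_plus; [eapply is_derive_affine; [exact dx | reflexivity] | ].
  transitivity (e * e * d * (z (s0 + e * s) * c (s0 + e * s))); [rewrite ee | ]; ring.
- eapply is_derive_affine; [exact dz_ | ring].
- eapply is_derive_scal_plus; [eapply is_derive_affine; [exact dc | reflexivity] | ].
  field; lra.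
- eapply is_derive_scal_plus; [eapply is_derive_affine; [exact ds | reflexivity] | ].
  transitivity (d * d * (c (s0 + e * s) *
    (2 * c (s0 + e * s) * ((1 - z (s0 + e * s)) / z (s0 + e * s))))).
    field; lra.
  rewrite dd; transitivity (e * e * (c (s0 + e * s) *
    (2 * c (s0 + e * s) * ((1 - z (s0 + e * s)) / z (s0 + e * s))))); [rewrite ee | ]; ring.
Qed.

Lemma unit_bound (c sg : R) : c ^ 2 + sg ^ 2 = 1 -> Rabs c <= 1 /\ Rabs sg <= 1.
Proof. intros u; split; apply Rabs_le; nra. Qed.

Lemma bilinear_bound (k N a b d : R) :
  Rabs k <= N -> k * (a * b) <= N * (a ^ 2 + b ^ 2 + d ^ 2).
Proof.
intros hk.
assert (N0 : 0 <= N) by (pose proof (Rabs_pos k); lra).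
apply Rle_trans with (1 := Rle_abs _); rewrite Rabs_mult.
apply Rmult_le_compat; [apply Rabs_pos | apply Rabs_pos | exact hk | ].
apply Rabs_le; nra.
Qed.

Lemma upper_bound_segment (f : R -> R) (a b : R) :
  a <= b -> (forall s, a <= s <= b -> continuous f s) ->
  exists M, forall s, a <= s <= b -> f s <= M.
Proof.
intros ab cf.
destruct (continuity_ab_maj f a b ab) as [m [hm _]].
  intros s hs; apply continuity_pt_filterlim, cf, hs.
exists (f m); exact hm.
Qed.

Lemma frame_inv_derive (x z c sg : R -> R) (s : R) :
  frame_at x z c sg s -> is_derive (fun s => / z s) s (- (/ z s * sg s)).
Proof.
intros [z0 [u [dx [dz_ _]]]]; evar_last.
  apply is_derive_inv; [exact dz_ | lra].
field; lra.
Qed.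

Lemma is_derive_sqr_minus (f g : R -> R) (s l m : R) :
  is_derive f s l -> is_derive g s m ->
  is_derive (fun s => (f s - g s) ^ 2) s (2 * (f s - g s) * (l - m)).
Proof.
intros df dg; evar_last.
  exact (is_derive_pow _ 2 s _ (is_derive_minus (V := R_NormedModule) f g s l m df dg)).
unfold minus, plus, opp; simpl; ring.
Qed.

(** The system is polynomial in (1/z, c, sg).  The components c, sg are
    bounded by 1 and 1/z is bounded on a compact time interval, so the squared distance
    of two solutions satisfies a linear differential inequality. *)
Lemma frame_unique_forward (x1 z1 c1 g1 x2 z2 c2 g2 : R -> R) (a b : R) :
  a <= b ->
  (forall s, a <= s <= b -> frame_at x1 z1 c1 g1 s) ->
  (forall s, a <= s <= b -> frame_at x2 z2 c2 g2 s) ->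
  z1 a = z2 a -> c1 a = c2 a -> g1 a = g2 a ->
  z1 b = z2 b /\ c1 b = c2 b /\ g1 b = g2 b.
Proof.
intros ab f1 f2 ez ec eg.
destruct (upper_bound_segment (fun s => / z1 s) a b ab) as [M hM].
  intros s hs; eapply continuous_of_derive, frame_inv_derive, f1, hs.
assert (M0 : 0 < M).
  apply Rlt_le_trans with (/ z1 a); [apply Rinv_0_lt_compat, f1 | apply hM]; lra.
set (D s := (/ z1 s - / z2 s) ^ 2 + (c1 s - c2 s) ^ 2 + (g1 s - g2 s) ^ 2).
set (V s := - (/ z1 s * g1 s) - - (/ z2 s * g2 s)).
set (C s := - (g1 s * turning (z1 s) (c1 s)) - - (g2 s * turning (z2 s) (c2 s))).
set (G s := c1 s * turning (z1 s) (c1 s) - c2 s * turning (z2 s) (c2 s)).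
assert (D0 : D b = 0).
  apply (gronwall_zero D (fun s => 2 * (/ z1 s - / z2 s) * V s
           + 2 * (c1 s - c2 s) * C s + 2 * (g1 s - g2 s) * G s)
           (22 * M + 40) a b ab).
  - intros s hs.
    pose proof (frame_inv_derive _ _ _ _ _ (f1 s hs)) as dv1.
    pose proof (frame_inv_derive _ _ _ _ _ (f2 s hs)) as dv2.
    destruct (f1 s hs) as [p1 [u1 [dx1 [dz1 [dc1 dg1]]]]].
    destruct (f2 s hs) as [p2 [u2 [dx2 [dz2 [dc2 dg2]]]]].
    exact (is_derive_plus (V := R_NormedModule) _ _ s _ _
      (is_derive_plus (V := R_NormedModule) _ _ s _ _
        (is_derive_sqr_minus _ _ _ _ _ dv1 dv2) (is_derive_sqr_minus _ _ _ _ _ dc1 dc2)) (is_derive_sqr_minus _ _ _ _ _ dg1 dg2)).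
  - intros s hs; unfold D.
    pose proof (pow2_ge_0 (/ z1 s - / z2 s)); pose proof (pow2_ge_0 (c1 s - c2 s)).
    pose proof (pow2_ge_0 (g1 s - g2 s)); lra.
  - intros s hs; unfold D, V, C, G, turning.
    specialize (hM s hs).
    destruct (f1 s hs) as [p1 [u1 _]]; destruct (f2 s hs) as [p2 [u2 _]].
    assert (q1 : 0 < / z1 s) by now apply Rinv_0_lt_compat.
    replace ((1 - z1 s) / z1 s) with (/ z1 s - 1) by (field; lra).
    replace ((1 - z2 s) / z2 s) with (/ z2 s - 1) by (field; lra).
    revert hM u1 u2 q1.
    generalize (/ z1 s) (/ z2 s) (c1 s) (c2 s) (g1 s) (g2 s).
    intros v w c d g h hM u1 u2 v0.
    destruct (unit_bound _ _ u1) as [bc bg]; destruct (unit_bound _ _ u2) as [bd bh].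
    assert (prod : forall p q A B, Rabs p <= A -> Rabs q <= B -> Rabs (p * q) <= A * B).
      intros p q A B hp hq; rewrite Rabs_mult.
      apply Rmult_le_compat; [apply Rabs_pos | apply Rabs_pos | exact hp | exact hq].
    assert (bv : Rabs (v - 1) <= M + 1) by (apply Rabs_le; lra).
    assert (bcd : Rabs (c + d) <= 2) by (apply Rle_trans with (1 := Rabs_triang _ _); lra).
    pose proof (bilinear_bound (- 2 * v) (2 * M) (v - w) (g - h) (c - d)) as t1.
    pose proof (bilinear_bound (- 2 * h) (2 * 1) (v - w) (v - w) 0) as t2.
    pose proof (bilinear_bound (- 4 * (c * (v - 1))) (4 * (1 * (M + 1))) (c - d) (g - h) (v - w)) as t3.
    pose proof (bilinear_bound (- 4 * (h * (v - 1))) (4 * (1 * (M + 1))) (c - d) (c - d) 0) as t4.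
    pose proof (bilinear_bound (- 4 * (h * d)) (4 * (1 * 1)) (v - w) (c - d) (g - h)) as t5.
    pose proof (bilinear_bound (4 * ((c + d) * (v - 1))) (4 * (2 * (M + 1))) (c - d) (g - h) (v - w)) as t6.
    pose proof (bilinear_bound (4 * (d * d)) (4 * (1 * 1)) (v - w) (g - h) (c - d)) as t7.
    assert (n2 : Rabs (-2) <= 2) by (apply Rabs_le; lra).
    assert (n4 : Rabs (-4) <= 4) by (apply Rabs_le; lra).
    assert (m4 : Rabs 4 <= 4) by (apply Rabs_le; lra).
    assert (bv' : Rabs v <= M) by (apply Rabs_le; lra).
    specialize (t1 (prod _ _ _ _ n2 bv')).
    specialize (t2 (prod _ _ _ _ n2 bh)).
    specialize (t3 (prod _ _ _ _ n4 (prod _ _ _ _ bc bv))).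
    specialize (t4 (prod _ _ _ _ n4 (prod _ _ _ _ bh bv))).
    specialize (t5 (prod _ _ _ _ n4 (prod _ _ _ _ bh bd))).
    specialize (t6 (prod _ _ _ _ m4 (prod _ _ _ _ bcd bv))).
    specialize (t7 (prod _ _ _ _ m4 (prod _ _ _ _ bd bd))).
    pose proof (pow2_ge_0 (v - w)); pose proof (pow2_ge_0 (c - d)).
    pose proof (pow2_ge_0 (g - h)).
    assert (0 <= M * (v - w) ^ 2) by (apply Rmult_le_pos; lra).
    assert (0 <= M * (c - d) ^ 2) by (apply Rmult_le_pos; lra).
    assert (0 <= M * (g - h) ^ 2) by (apply Rmult_le_pos; lra).
    clear - t1 t2 t3 t4 t5 t6 t7 H H0 H1 H2 H3 H4.
    lra.
  - unfold D; rewrite ez, ec, eg; ring.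
unfold D in D0.
pose proof (pow2_ge_0 (/ z1 b - / z2 b)); pose proof (pow2_ge_0 (c1 b - c2 b)).
pose proof (pow2_ge_0 (g1 b - g2 b)).
assert (zero : forall r, r ^ 2 = 0 -> r = 0) by (intros r hr; nra).
split; [ | split; apply Rminus_diag_uniq, zero; lra].
rewrite <- (Rinv_inv (z1 b)), <- (Rinv_inv (z2 b)); f_equal.
apply Rminus_diag_uniq, zero; lra.
Qed.

Definition convex (P : R -> Prop) := forall a b s, P a -> P b -> a <= s <= b -> P s.

Definition always (s : R) : Prop := True.

Lemma always_convex : convex always.
Proof. intros a b s _ _ _; exact I. Qed.

Lemma convex_const (P : R -> Prop) (f : R -> R) (s0 s : R) :
  convex P -> (forall s, P s -> is_derive f s 0) -> P s0 -> P s -> f s = f s0.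
Proof.
intros cv df P0 Ps; destruct (Rle_or_lt s0 s) as [l | l].
- symmetry; apply derive_zero_const; [exact l | ].
  intros t ht; apply df; now apply cv with s0 s.
- apply derive_zero_const; [lra | ].
  intros t ht; apply df; now apply cv with s s0.
Qed.

Lemma frame_unique (P : R -> Prop) (x1 z1 c1 g1 x2 z2 c2 g2 : R -> R) (s0 : R) :
  convex P -> P s0 ->
  (forall s, P s -> frame_at x1 z1 c1 g1 s) ->
  (forall s, P s -> frame_at x2 z2 c2 g2 s) ->
  z1 s0 = z2 s0 -> c1 s0 = c2 s0 -> g1 s0 = g2 s0 ->
  forall s, P s -> z1 s = z2 s /\ c1 s = c2 s /\ g1 s = g2 s /\
    x1 s - x1 s0 = x2 s - x2 s0.
Proof.
intros cv P0 f1 f2 ez ec eg.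
assert (eq : forall s, P s -> z1 s = z2 s /\ c1 s = c2 s /\ g1 s = g2 s).
  intros s Ps; destruct (Rle_or_lt s0 s) as [l | l].
    apply (frame_unique_forward x1 z1 c1 g1 x2 z2 c2 g2 s0 s l); auto;
      intros t ht; [apply f1 | apply f2]; now apply cv with s0 s.
  (* To the left of s0, both solutions are run backwards in time. *)
  assert (h := frame_unique_forward _ _ _ _ _ _ _ _ (- s0) (- s) (Rlt_le _ _ (Ropp_lt_contravar _ _ l))
    (fun t ht => frame_symmetry x1 z1 c1 g1 0 1 (-1) 0 t (or_introl eq_refl)
      (or_intror eq_refl) (f1 _ (cv s s0 (0 + -1 * t) Ps P0 ltac:(lra))))
    (fun t ht => frame_symmetry x2 z2 c2 g2 0 1 (-1) 0 t (or_introl eq_refl)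
      (or_intror eq_refl) (f2 _ (cv s s0 (0 + -1 * t) Ps P0 ltac:(lra))))).
  simpl in h.
  replace (0 + -1 * - s0) with s0 in h by ring.
  replace (0 + -1 * - s) with s in h by ring.
  rewrite ez, ec, eg in h; specialize (h eq_refl eq_refl eq_refl).
  lra.
intros s Ps; destruct (eq s Ps) as [e1 [e2 e3]].
split; [exact e1 | split; [exact e2 | split; [exact e3 | ]]].
assert (d0 : forall t, P t -> is_derive (fun t => x1 t - x2 t) t 0).
  intros t Pt.
  destruct (f1 t Pt) as [_ [_ [d1 _]]]; destruct (f2 t Pt) as [_ [_ [d2 _]]].
  evar_last; [exact (is_derive_minus (V := R_NormedModule) _ _ _ _ _ d1 d2) | ].
  destruct (eq t Pt) as [-> [-> _]]; apply Rminus_diag.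
assert (h := convex_const P _ s0 s cv d0 P0 Ps); simpl in h; lra.
Qed.

(** The derivative of potential is (z - 1)/z^2, hence
    (log c)' = - 2 sg (1 - z)/z = 2 (potential z)'.  Stating it multiplicatively covers
    c = 0 and c < 0 too. *)
Lemma first_integral (P : R -> Prop) (x z c sg : R -> R) (s0 : R) :
  convex P -> P s0 -> (forall s, P s -> frame_at x z c sg s) ->
  forall s, P s -> c s = c s0 * exp (2 * (potential (z s) - potential (z s0))).
Proof.
intros cv P0 fr s Ps.
set (J s := c s * exp (- 2 * potential (z s))).
assert (dJ : forall s, P s -> is_derive J s 0).
  intros t Pt; destruct (fr t Pt) as [z0 [u [dx [dz_ [dc _]]]]].
  evar_last.
    apply (is_derive_mult c (fun t => exp (- 2 * potential (z t)))); [exact dc | | ].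
    - apply (is_derive_comp exp (fun t => - 2 * potential (z t))); [apply is_derive_exp | ].
      apply (is_derive_scal (fun t => potential (z t))).
      apply (is_derive_comp potential z); [now apply potential_derive | exact dz_].
    - intros n m; apply Rmult_comm.
  unfold plus, mult, scal; simpl; unfold mult, turning; simpl; field; lra.
assert (e : J s = J s0) by now apply convex_const with P.
unfold J in e.
replace (2 * (potential (z s) - potential (z s0)))
  with (- 2 * potential (z s0) + - (- 2 * potential (z s))) by ring.
rewrite exp_plus, exp_Ropp, <- Rmult_assoc, <- e.
field; apply Rgt_not_eq, exp_pos.
Qed.

(** * Curvature of ruled surfaces *)

Lemma vec3_eq (a b c a' b' c' : R) : a = a' -> b = b' -> c = c' -> V3 a b c = V3 a' b' c'.
Proof. now intros -> -> ->. Qed.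

Lemma du_ruled (g : curve) (u v : R) :
  du (ruled g) u v = V3 (Derive (cx g) u) 0 (Derive (cz g) u).
Proof. apply vec3_eq; [reflexivity | exact (Derive_const v u) | reflexivity]. Qed.

Lemma dv_ruled (g : curve) (u v : R) : dv (ruled g) u v = V3 0 1 0.
Proof. apply vec3_eq; [exact (Derive_const (cx g u) v) | exact (Derive_id v) | exact (Derive_const (cz g u) v)]. Qed.

Lemma du_du_ruled (g : curve) (u v : R) :
  du (du (ruled g)) u v = V3 (Derive (Derive (cx g)) u) 0 (Derive (Derive (cz g)) u).
Proof.
apply vec3_eq; [reflexivity | | reflexivity].
rewrite (Derive_ext _ (fun _ => 0)); [apply Derive_const | ].
intros t; exact (Derive_const v t).
Qed.

Lemma du_dv_ruled (g : curve) (u v : R) : du (dv (ruled g)) u v = V3 0 0 0.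
Proof.
unfold du; apply vec3_eq;
  (erewrite Derive_ext; [ | intros t; rewrite dv_ruled; simpl; reflexivity]);
  apply Derive_const.
Qed.

Lemma dv_dv_ruled (g : curve) (u v : R) : dv (dv (ruled g)) u v = V3 0 0 0.
Proof.
unfold dv at 1; apply vec3_eq;
  (erewrite Derive_ext; [ | intros t; rewrite dv_ruled; simpl; reflexivity]);
  apply Derive_const.
Qed.

Lemma normal_ruled (g : curve) (s t : R) :
  0 < cz g s -> Derive (cx g) s ^ 2 + Derive (cz g) s ^ 2 = cz g s ^ 2 ->
  normal (ruled g) s t = V3 (- Derive (cz g) s) 0 (Derive (cx g) s).
Proof.
intros z0 unit; unfold normal; rewrite du_ruled, dv_ruled; simpl.
unfold dot; simpl.
match goal with |- context [sqrt ?r] => replace r with (cz g s ^ 2) by (rewrite <- unit; ring) end.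
rewrite sqrt_pow2 by lra.
unfold vscal; simpl; apply vec3_eq; field; lra.
Qed.

Lemma second_form_ruled (g : curve) (s t : R) :
  0 < cz g s -> Derive (cx g) s ^ 2 + Derive (cz g) s ^ 2 = cz g s ^ 2 ->
  II11 (ruled g) s t = (Derive (cx g) s * Derive (Derive (cz g)) s
    - Derive (cz g) s * Derive (Derive (cx g)) s + cz g s * Derive (cx g) s) / cz g s ^ 2 /\
  II12 (ruled g) s t = 0 /\ II22 (ruled g) s t = Derive (cx g) s / cz g s ^ 3.
Proof.
intros z0 unit; split; [ | split].
- unfold II11; rewrite normal_ruled, du_du_ruled, du_ruled by assumption.
  unfold hmetric, christoffel, vadd, vscal, dot; simpl.
  transitivity ((Derive (cx g) s * Derive (Derive (cz g)) s
   - Derive (cz g) s * Derive (Derive (cx g)) s +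
   (Derive (cx g) s ^ 2 + Derive (cz g) s ^ 2) * Derive (cx g) s / cz g s) / cz g s ^ 2).
    field; lra.
  rewrite unit; field; lra.
- unfold II12; rewrite normal_ruled, du_dv_ruled, dv_ruled, du_ruled by assumption.
  unfold hmetric, christoffel, vadd, vscal, dot; simpl; field; lra.
- unfold II22; rewrite normal_ruled, dv_dv_ruled, dv_ruled by assumption.
  unfold hmetric, christoffel, vadd, vscal, dot; simpl; field; lra.
Qed.

(** On an arc-length parametrized curve the first fundamental form is
    diagonal with entries 1 and 1/z^2, so both sides of the horo-shrinker equation become
    multiples of 1/(2 z^2). *)
Lemma horo_shrinker_ruled (g : curve) (s t : R) :
  0 < cz g s -> Derive (cx g) s ^ 2 + Derive (cz g) s ^ 2 = cz g s ^ 2 ->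
  horo_shrinker_at (ruled g) s t <->
  Derive (cx g) s * Derive (Derive (cz g)) s - Derive (cz g) s * Derive (Derive (cx g)) s
    = 2 * Derive (cx g) s * (1 - cz g s).
Proof.
intros z0 unit.
assert (i11 : I11 (ruled g) s t = 1).
  unfold I11, hmetric, dot; rewrite du_ruled; simpl.
  transitivity ((Derive (cx g) s ^ 2 + Derive (cz g) s ^ 2) / cz g s ^ 2); [field; lra | ].
  rewrite unit; field; lra.
assert (i12 : I12 (ruled g) s t = 0).
  unfold I12, hmetric, dot; rewrite du_ruled, dv_ruled; simpl; field; lra.
assert (i22 : I22 (ruled g) s t = / cz g s ^ 2).
  unfold I22, hmetric, dot; rewrite dv_ruled; simpl; field; lra.
destruct (second_form_ruled g s t z0 unit) as [j11 [j12 j22]].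
assert (v0 : 0 < / cz g s ^ 2) by (apply Rinv_0_lt_compat, pow_lt, z0).
unfold horo_shrinker_at, immersed_at, mean_curvature.
rewrite normal_ruled, i11, i12, i22, j11, j12, j22 by assumption.
unfold hmetric, dot; simpl.
set (w := Derive (cx g) s * Derive (Derive (cz g)) s - Derive (cz g) s * Derive (Derive (cx g)) s).
set (a := Derive (cx g) s).
match goal with |- (_ /\ ?l = ?r) <-> _ =>
  replace l with ((w + 2 * cz g s * a) / (2 * cz g s ^ 2)) by (field; lra);
  replace r with (2 * a / (2 * cz g s ^ 2)) by (field; lra) end.
assert (zz : 0 < 2 * cz g s ^ 2) by (pose proof (pow_lt _ 2 z0); lra).
split.
- intros [_ e].
  apply (f_equal (fun r => r * (2 * cz g s ^ 2))) in e.
  unfold Rdiv in e; rewrite !Rmult_assoc, Rinv_l, !Rmult_1_r in e by lra.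
  lra.
- intros e; split.
    split; [exact z0 | simpl in v0; lra].
  f_equal; lra.
Qed.

Lemma dom_convex (g : curve) : convex (dom g).
Proof.
intros a b s [la _] [_ bh] [as_ sb]; split.
- destruct (lo g); simpl in *; [lra | contradiction | exact I].
- destruct (hi g); simpl in *; [lra | exact I | contradiction].
Qed.

Lemma dom_locally (g : curve) (s : R) : dom g s -> locally s (dom g).
Proof.
intros [l h]; apply filter_and.
- now apply (open_Rbar_gt' (Finite s) (lo g)).
- now apply (open_Rbar_lt' (Finite s) (hi g)).
Qed.

Definition tangent_x (g : curve) (s : R) : R := Derive (cx g) s / cz g s.
Definition tangent_z (g : curve) (s : R) : R := Derive (cz g) s / cz g s.

Lemma smooth_ex_derive (f : R -> R) (s : R) :
  smooth_at f s -> ex_derive f s /\ ex_derive (Derive f) s.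
Proof. intros sm; split; [exact (sm 1%nat) | exact (sm 2%nat)]. Qed.

Lemma div_sqr_eq_1 (a z : R) : 0 < z -> a / z ^ 2 = 1 -> a = z ^ 2.
Proof.
intros z0 e; rewrite <- (Rmult_1_l (z ^ 2)), <- e; field; lra.
Qed.

Lemma grim_reaper_frame (g : curve) (s : R) :
  grim_reaper g -> dom g s ->
  frame_at (cx g) (cz g) (tangent_x g) (tangent_z g) s.
Proof.
intros [_ gr] ds; destruct (gr s ds) as [smx [smz [z0 [unit hs]]]].
apply div_sqr_eq_1 in unit; [ | exact z0].
specialize (hs 0); apply (horo_shrinker_ruled g s 0 z0 unit) in hs.
destruct (smooth_ex_derive _ _ smx) as [ex1 ex2].
destruct (smooth_ex_derive _ _ smz) as [ez1 ez2].
apply Derive_correct in ex1, ex2, ez1, ez2.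
(* Differentiating the arc-length condition gives the second equation for the
   second derivatives. *)
assert (diff : 2 * Derive (cx g) s * Derive (Derive (cx g)) s
  + 2 * Derive (cz g) s * Derive (Derive (cz g)) s = 2 * cz g s * Derive (cz g) s).
  assert (d1 : is_derive (fun s => Derive (cx g) s ^ 2 + Derive (cz g) s ^ 2) s
    (2 * Derive (cx g) s * Derive (Derive (cx g)) s
      + 2 * Derive (cz g) s * Derive (Derive (cz g)) s)).
    evar_last.
      exact (is_derive_plus (V := R_NormedModule) _ _ s _ _
        (is_derive_pow _ 2 s _ ex2) (is_derive_pow _ 2 s _ ez2)).
    unfold plus; simpl; ring.
  assert (d2 : is_derive (fun s => cz g s ^ 2) s (2 * cz g s * Derive (cz g) s)).
    evar_last; [exact (is_derive_pow _ 2 s _ ez1) | simpl; ring].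
  rewrite <- (is_derive_unique _ _ _ d2); symmetry; apply is_derive_unique.
  apply is_derive_ext_loc with (2 := d1).
  apply filter_imp with (2 := dom_locally g s ds); intros t dt.
  destruct (gr t dt) as [_ [_ [t0 [u _]]]]; now apply div_sqr_eq_1.
unfold frame_at, tangent_x, tangent_z, turning.
revert hs diff unit ex1 ex2 ez1 ez2 z0.
generalize (Derive (Derive (cx g)) s) (Derive (Derive (cz g)) s).
intros a2 b2 hs diff unit ex1 ex2 ez1 ez2 z0.
assert (ea2 : a2 = (3 * cz g s - 2) * Derive (cx g) s * Derive (cz g) s / cz g s ^ 2).
  apply (Rmult_eq_reg_r (cz g s ^ 2)); [ | pose proof (pow_lt _ 2 z0); lra].
  unfold Rdiv; rewrite (Rmult_assoc _ (/ _)), Rinv_l, Rmult_1_r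
    by (pose proof (pow_lt _ 2 z0); lra).
  rewrite <- unit.
  replace (a2 * (Derive (cx g) s ^ 2 + Derive (cz g) s ^ 2))
    with (Derive (cx g) s * (2 * Derive (cx g) s * a2 + 2 * Derive (cz g) s * b2) / 2
      - Derive (cz g) s * (Derive (cx g) s * b2 - Derive (cz g) s * a2)) by field.
  rewrite hs, diff; field.
assert (eb2 : b2 = (cz g s * Derive (cz g) s ^ 2 + 2 * Derive (cx g) s ^ 2 * (1 - cz g s)) / cz g s ^ 2).
  apply (Rmult_eq_reg_r (cz g s ^ 2)); [ | pose proof (pow_lt _ 2 z0); lra].
  unfold Rdiv; rewrite (Rmult_assoc _ (/ _)), Rinv_l, Rmult_1_r
    by (pose proof (pow_lt _ 2 z0); lra).
  rewrite <- unit at 1.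
  replace (b2 * (Derive (cx g) s ^ 2 + Derive (cz g) s ^ 2))
    with (Derive (cz g) s * (2 * Derive (cx g) s * a2 + 2 * Derive (cz g) s * b2) / 2
      + Derive (cx g) s * (Derive (cx g) s * b2 - Derive (cz g) s * a2)) by field.
  rewrite hs, diff; field.
clear hs diff gr smx smz.
split; [exact z0 | ].
split; [ | split; [ | split; [ | split]]].
- transitivity ((Derive (cx g) s ^ 2 + Derive (cz g) s ^ 2) / cz g s ^ 2); [field; lra | ].
  rewrite unit; field; lra.
- evar_last; [exact ex1 | field; lra].
- evar_last; [exact ez1 | field; lra].
- evar_last; [apply (is_derive_div _ _ s _ _ ex2 ez1); lra | ].
  rewrite ea2; field; lra.
- evar_last; [apply (is_derive_div _ _ s _ _ ez2 ez1); lra | ].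
  rewrite eb2.
  transitivity ((cz g s * Derive (cz g) s ^ 2 + 2 * Derive (cx g) s ^ 2 * (1 - cz g s)
    - cz g s * Derive (cz g) s ^ 2) / cz g s ^ 3); field; lra.
Qed.

(** * Smoothness by closure under differentiation *)

(** A class of functions containing a derivative of each of its generators
    contains, by the product rule, all derivatives of all its elements. *)
Inductive algebra (gen : (R -> R) -> Prop) : (R -> R) -> Prop :=
| alg_gen f : gen f -> algebra gen f
| alg_const k : algebra gen (fun _ => k)
| alg_plus f g : algebra gen f -> algebra gen g -> algebra gen (fun s => f s + g s)
| alg_mult f g : algebra gen f -> algebra gen g -> algebra gen (fun s => f s * g s).

Lemma algebra_smooth (gen : (R -> R) -> Prop) :
  (forall f, gen f -> exists f', algebra gen f' /\ forall s, is_derive f s (f' s)) ->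
  forall f, algebra gen f -> forall s, smooth_at f s.
Proof.
intros dgen.
assert (closed : forall f, algebra gen f ->
  exists f', algebra gen f' /\ forall s, is_derive f s (f' s)).
  intros f Af; induction Af as [f gf | k | f g Af [f' [Af' df]] Ag [g' [Ag' dg]]
                               | f g Af [f' [Af' df]] Ag [g' [Ag' dg]]].
  - now apply dgen.
  - exists (fun _ => 0); split; [apply alg_const | ].
    intros s; exact (is_derive_const (V := R_NormedModule) k s).
  - exists (fun s => f' s + g' s); split; [now apply alg_plus | ].
    intros s; exact (is_derive_plus (V := R_NormedModule) f g s _ _ (df s) (dg s)).
  - exists (fun s => f' s * g s + f s * g' s); split.
      now apply alg_plus; apply alg_mult.
    intros s; exact (is_derive_mult f g s _ _ (df s) (dg s) Rmult_comm).
assert (iter : forall n f, algebra gen f ->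
  exists g, algebra gen g /\ forall s, Derive_n f n s = g s).
  induction n as [ | n IH]; intros f Af.
    now exists f.
  destruct (IH f Af) as [g [Ag e]]; destruct (closed g Ag) as [g' [Ag' dg]].
  exists g'; split; [exact Ag' | intros s].
  simpl; rewrite (Derive_ext _ g s e); now apply is_derive_unique.
intros f Af s [ | n]; [exact I | ].
destruct (iter n f Af) as [g [Ag e]]; destruct (closed g Ag) as [g' [Ag' dg]].
apply (ex_derive_ext g); [intros t; symmetry; apply e | ].
exists (g' s); apply dg.
Qed.

(** x, z, 1/z, c, sg generate an algebra closed under differentiation. *)
Lemma frame_smooth (x z c sg : R -> R) :
  (forall s, frame_at x z c sg s) -> forall s, smooth_at x s /\ smooth_at z s.
Proof.
intros fr.
set (gen f := f = x \/ f = z \/ f = (fun s => / z s) \/ f = c \/ f = sg).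
assert (gx : algebra gen x) by (apply alg_gen; unfold gen; tauto).
assert (gz : algebra gen z) by (apply alg_gen; unfold gen; tauto).
assert (gv : algebra gen (fun s => / z s)) by (apply alg_gen; unfold gen; tauto).
assert (gc : algebra gen c) by (apply alg_gen; unfold gen; tauto).
assert (gs : algebra gen sg) by (apply alg_gen; unfold gen; tauto).
assert (gk : algebra gen (fun s => 2 * c s * (/ z s + -1))).
  repeat first [exact gc | exact gv | apply alg_plus | apply alg_mult | apply alg_const].
assert (dgen : forall f, gen f ->
  exists f', algebra gen f' /\ forall s, is_derive f s (f' s)).
  intros f [-> | [-> | [-> | [-> | ->]]]].
  - exists (fun s => z s * c s); split; [now apply alg_mult | ].
    intros s; destruct (fr s) as [_ [_ [d _]]]; exact d.
  - exists (fun s => z s * sg s); split; [now apply alg_mult | ].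
    intros s; destruct (fr s) as [_ [_ [_ [d _]]]]; exact d.
  - exists (fun s => -1 * (/ z s * sg s)); split.
      apply alg_mult; [apply alg_const | now apply alg_mult].
    intros s; evar_last; [exact (frame_inv_derive _ _ _ _ _ (fr s)) | ring].
  - exists (fun s => -1 * (sg s * (2 * c s * (/ z s + -1)))); split.
      apply alg_mult; [apply alg_const | now apply alg_mult].
    intros s; destruct (fr s) as [z0 [_ [_ [_ [d _]]]]].
    evar_last; [exact d | unfold turning; field; lra].
  - exists (fun s => c s * (2 * c s * (/ z s + -1))); split; [now apply alg_mult | ].
    intros s; destruct (fr s) as [z0 [_ [_ [_ [_ d]]]]].
    evar_last; [exact d | unfold turning; field; lra].
intros s; split; now apply algebra_smooth with gen.
Qed.

Definition complete_curve (x z : R -> R) : curve := Curve m_infty p_infty x z.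

Lemma frame_grim_reaper (x z c sg : R -> R) :
  (forall s, frame_at x z c sg s) -> grim_reaper (complete_curve x z).
Proof.
intros fr; split; [exact I | intros s _].
destruct (frame_smooth _ _ _ _ fr s) as [smx smz].
assert (Dx : forall s, Derive x s = z s * c s).
  intros t; apply is_derive_unique; now destruct (fr t) as [_ [_ [d _]]].
assert (Dz : forall s, Derive z s = z s * sg s).
  intros t; apply is_derive_unique; now destruct (fr t) as [_ [_ [_ [d _]]]].
destruct (fr s) as [z0 [u [dx [dz_ [dc ds]]]]].
assert (Dxx : Derive (Derive x) s = z s * sg s * c s + z s * - (sg s * turning (z s) (c s))).
  rewrite (Derive_ext _ _ s Dx); apply is_derive_unique.
  exact (is_derive_mult z c s _ _ dz_ dc Rmult_comm).
assert (Dzz : Derive (Derive z) s = z s * sg s * sg s + z s * (c s * turning (z s) (c s))).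
  rewrite (Derive_ext _ _ s Dz); apply is_derive_unique.
  exact (is_derive_mult z sg s _ _ dz_ ds Rmult_comm).
assert (unit : Derive x s ^ 2 + Derive z s ^ 2 = z s ^ 2).
  rewrite Dx, Dz; transitivity (z s ^ 2 * (c s ^ 2 + sg s ^ 2)); [ | rewrite u]; ring.
split; [exact smx | split; [exact smz | split; [exact z0 | split]]].
  simpl cx; simpl cz; rewrite unit; field; lra.
intros t; apply horo_shrinker_ruled; [exact z0 | exact unit | simpl].
rewrite Dxx, Dzz, Dx, Dz.
transitivity (z s ^ 2 * (c s ^ 2 + sg s ^ 2) * turning (z s) (c s)); [ring | ].
rewrite u; unfold turning; field; lra.
Qed.

Lemma complete_maximal (x z : R -> R) :
  grim_reaper (complete_curve x z) -> maximal_grim_reaper (complete_curve x z).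
Proof. intros gr; split; [exact gr | ]; intros; split; exact I. Qed.

(** * Existence of the profile curves *)

Lemma lipschitz_of_derive (f f' : R -> R) (K a b : R) :
  (forall s, Rmin a b <= s <= Rmax a b -> is_derive f s (f' s)) ->
  (forall s, Rmin a b <= s <= Rmax a b -> Rabs (f' s) <= K) ->
  Rabs (f a - f b) <= K * Rabs (a - b).
Proof.
intros df bf.
destruct (MVT_gen f b a f') as [c [hc e]].
- intros s hs; rewrite Rmin_comm, Rmax_comm in hs; apply df; lra.
- intros s hs; rewrite Rmin_comm, Rmax_comm in hs.
  apply continuity_pt_filterlim; eapply continuous_of_derive, df, hs.
- rewrite e, Rabs_mult; apply Rmult_le_compat_r; [apply Rabs_pos | ].
  rewrite Rmin_comm, Rmax_comm in hc; apply bf, hc.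
Qed.

Lemma sin_lipschitz (a b : R) : Rabs (sin a - sin b) <= Rabs (a - b).
Proof.
rewrite <- (Rmult_1_l (Rabs (a - b))).
apply lipschitz_of_derive with (f' := cos).
- intros s _; apply is_derive_Reals, derivable_pt_lim_sin.
- intros s _; apply Rabs_le; pose proof (COS_bound s); lra.
Qed.

Lemma cos_lipschitz (a b : R) : Rabs (cos a - cos b) <= Rabs (a - b).
Proof.
rewrite <- (Rmult_1_l (Rabs (a - b))).
apply lipschitz_of_derive with (f' := fun s => - sin s).
- intros s _; apply is_derive_Reals, derivable_pt_lim_cos.
- intros s _; apply Rabs_le; pose proof (SIN_bound s); lra.
Qed.

Lemma Rmax_lipschitz (a b m : R) : Rabs (Rmax a m - Rmax b m) <= Rabs (a - b).
Proof.
unfold Rmax; destruct (Rle_dec a m), (Rle_dec b m);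
  unfold Rabs; repeat destruct Rcase_abs; lra.
Qed.

(** The force exp (- w) - 1 in the variable w = log z, frozen below w0 to make it
    bounded and globally Lipschitz. *)
Definition clamped (w0 w : R) : R := exp (- Rmax w w0) - 1.

Lemma clamped_bound (w0 w : R) : Rabs (clamped w0 w) <= exp (- w0) + 1.
Proof.
unfold clamped; pose proof (exp_pos (- Rmax w w0)).
pose proof (exp_pos (- w0)).
assert (exp (- Rmax w w0) <= exp (- w0)).
  apply exp_le_exp; pose proof (Rmax_r w w0); lra.
apply Rabs_le; lra.
Qed.

Lemma clamped_lipschitz (w0 a b : R) :
  Rabs (clamped w0 a - clamped w0 b) <= exp (- w0) * Rabs (a - b).
Proof.
apply Rle_trans with (exp (- w0) * Rabs (Rmax a w0 - Rmax b w0)).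
- apply (lipschitz_of_derive (fun r => exp (- r) - 1) (fun r => - exp (- r))).
  + intros s _; auto_derive; [exact I | ring].
  + intros s hs; rewrite Rabs_Ropp, Rabs_pos_eq by apply Rlt_le, exp_pos.
    apply exp_le_exp.
    pose proof (Rmax_r a w0); pose proof (Rmax_r b w0).
    pose proof (Rmin_glb _ _ _ H H0); lra.
- apply Rmult_le_compat_l; [apply Rlt_le, exp_pos | apply Rmax_lipschitz].
Qed.

Lemma clamped_continuous (w0 w : R) : continuous (clamped w0) w.
Proof.
apply (lipschitz2_continuous (exp (- w0)) (fun a _ => clamped w0 a) (fun w => w) (fun w => w)).
- apply exp_pos.
- intros a b a' b'; apply Rle_trans with (1 := clamped_lipschitz _ _ _).
  apply Rmult_le_compat_l; [apply Rlt_le, exp_pos | ].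
  pose proof (Rabs_pos (b - b')); lra.
- apply continuous_id.
- apply continuous_id.
Qed.

Lemma clamped_solution (w0 : R) :
  exists w th : R -> R, w 0 = w0 /\ th 0 = 0 /\
    forall s, is_derive w s (sin (th s)) /\
              is_derive th s (2 * cos (th s) * clamped w0 (w s)).
Proof.
set (H := exp (- w0) + 1).
assert (H1 : 1 < H) by (unfold H; pose proof (exp_pos (- w0)); lra).
apply (picard_lindelof (fun _ th => sin th) (fun w th => 2 * cos th * clamped w0 w)
         (2 * H) (2 * H)).
- lra.
- intros a b a' b'; apply Rle_trans with (1 := sin_lipschitz _ _).
  pose proof (Rabs_pos (a - a')); pose proof (Rabs_pos (b - b')); nra.
- intros a b a' b'.
  replace (2 * cos b * clamped w0 a - 2 * cos b' * clamped w0 a')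
    with (2 * ((cos b - cos b') * clamped w0 a + cos b' * (clamped w0 a - clamped w0 a'))) by ring.
  rewrite Rabs_mult, (Rabs_pos_eq 2) by lra.
  rewrite Rmult_assoc; apply Rmult_le_compat_l; [lra | ].
  apply Rle_trans with (1 := Rabs_triang _ _); rewrite !Rabs_mult.
  pose proof (cos_lipschitz b b') as l1; pose proof (clamped_bound w0 a) as l2.
  pose proof (clamped_lipschitz w0 a a') as l3.
  assert (l4 : Rabs (cos b') <= 1) by (apply Rabs_le; pose proof (COS_bound b'); lra).
  assert (m1 : Rabs (cos b - cos b') * Rabs (clamped w0 a) <= Rabs (b - b') * H).
    apply Rmult_le_compat; [apply Rabs_pos | apply Rabs_pos | exact l1 | exact l2].
  assert (m2 : Rabs (cos b') * Rabs (clamped w0 a - clamped w0 a')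
               <= 1 * (exp (- w0) * Rabs (a - a'))).
    apply Rmult_le_compat; [apply Rabs_pos | apply Rabs_pos | exact l4 | exact l3].
  unfold H in *; pose proof (Rabs_pos (a - a')); lra.
- intros _ b; apply Rabs_le; pose proof (SIN_bound b); lra.
- intros a b; rewrite !Rabs_mult, (Rabs_pos_eq 2) by lra.
  assert (l4 : Rabs (cos b) <= 1) by (apply Rabs_le; pose proof (COS_bound b); lra).
  pose proof (clamped_bound w0 a) as l2; fold H in l2.
  rewrite Rmult_assoc; apply Rmult_le_compat_l; [lra | ].
  rewrite <- (Rmult_1_l H); apply Rmult_le_compat;
    [apply Rabs_pos | apply Rabs_pos | exact l4 | exact l2].
Qed.

(** The clamped system has a first integral too, cos theta exp (K w)
    with K a primitive of twice the force; below w0 it would give a cosine above 1. *)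
Lemma clamped_solution_stays (w0 : R) (w th : R -> R) :
  w0 < 0 -> w 0 = w0 -> th 0 = 0 ->
  (forall s, is_derive w s (sin (th s)) /\
             is_derive th s (2 * cos (th s) * clamped w0 (w s))) ->
  forall s, w0 <= w s.
Proof.
intros w00 e0 t0 sol s.
destruct (Rle_or_lt w0 (w s)) as [l | l]; [exact l | exfalso].
set (K r := 2 * RInt (clamped w0) w0 r).
assert (dK : forall r, is_derive K r (2 * clamped w0 r)).
  intros r; apply (is_derive_scal (fun r => RInt (clamped w0) w0 r)).
  apply is_derive_primitive, clamped_continuous.
assert (J : cos (th s) * exp (K (w s)) = cos (th 0) * exp (K (w 0))).
  apply (convex_const always (fun s => cos (th s) * exp (K (w s))));
    [exact always_convex | | exact I | exact I].
  clear s l; intros s _; destruct (sol s) as [dw dth].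
  evar_last.
    apply (is_derive_mult (fun s => cos (th s)) (fun s => exp (K (w s)))).
    - apply (is_derive_comp cos th); [apply is_derive_Reals, derivable_pt_lim_cos | exact dth].
    - apply (is_derive_comp exp (fun s => K (w s))); [apply is_derive_exp | ].
      apply (is_derive_comp K w); [apply dK | exact dw].
    - exact Rmult_comm.
  unfold plus, mult, scal; simpl; unfold mult; simpl; ring.
assert (K0 : K (w 0) = 0).
  rewrite e0; unfold K; rewrite RInt_point; apply Rmult_0_r.
rewrite t0, cos_0, K0, exp_0 in J.
(* Below w0 the clamped force is constant and positive, so K is negative there
   and the cosine would have to exceed 1. *)
destruct (mean_value K (fun r => 2 * clamped w0 r) (w s) w0 l) as [c [hc ec]].
  intros r _; apply dK.
rewrite <- e0, K0 in ec at 1.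
assert (pos : 0 < clamped w0 c).
  unfold clamped; rewrite Rmax_right by lra.
  assert (exp 0 < exp (- w0)) by (apply exp_increasing; lra).
  rewrite exp_0 in H; lra.
assert (neg : K (w s) < 0) by nra.
assert (exp (K (w s)) < 1) by (rewrite <- exp_0; now apply exp_increasing).
pose proof (exp_pos (K (w s))); pose proof (COS_bound (th s)); nra.
Qed.

Definition profile (z0 : R) (x z th : R -> R) : Prop :=
  x 0 = 0 /\ z 0 = z0 /\ th 0 = 0 /\
  forall s, 0 < z s /\
    is_derive x s (z s * cos (th s)) /\
    is_derive z s (z s * sin (th s)) /\
    is_derive th s (2 * cos (th s) * ((1 - z s) / z s)).

Lemma profile_exists (z0 : R) : 0 < z0 < 1 -> exists x z th, profile z0 x z th.
Proof.
intros hz.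
assert (w00 : ln z0 < 0) by (rewrite <- ln_1; apply ln_increasing; lra).
destruct (clamped_solution (ln z0)) as [w [th [e0 [t0 sol]]]].
assert (stay := clamped_solution_stays _ _ _ w00 e0 t0 sol).
assert (dz_ : forall s, is_derive (fun s => exp (w s)) s (exp (w s) * sin (th s))).
  intros s; destruct (sol s) as [dw _]; evar_last.
    apply (is_derive_comp exp w); [apply is_derive_exp | exact dw].
  unfold scal; simpl; unfold mult; simpl; ring.
assert (cont : forall s, continuous (fun s => exp (w s) * cos (th s)) s).
  intros s; apply (continuous_mult (K := R_AbsRing)).
  - eapply continuous_of_derive, dz_.
  - destruct (sol s) as [_ dth].
    apply (continuous_comp th cos); [exact (continuous_of_derive _ _ _ dth) | ].
    apply continuous_cos.
exists (fun s => 0 + RInt (fun s => exp (w s) * cos (th s)) 0 s), (fun s => exp (w s)), th.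
split; [rewrite RInt_point; apply Rplus_0_r | ].
split; [rewrite e0; apply exp_ln; lra | split; [exact t0 | intros s]].
split; [apply exp_pos | split; [ | split]].
- now apply (is_derive_plus_primitive 0 (fun s => exp (w s) * cos (th s))).
- apply dz_.
- destruct (sol s) as [_ dth]; evar_last; [exact dth | ].
  unfold clamped; rewrite Rmax_left by apply stay.
  rewrite exp_Ropp; field; apply Rgt_not_eq, exp_pos.
Qed.

Lemma angle_frame (x z th : R -> R) (s : R) :
  0 < z s -> is_derive x s (z s * cos (th s)) -> is_derive z s (z s * sin (th s)) ->
  is_derive th s (2 * cos (th s) * ((1 - z s) / z s)) ->
  frame_at x z (fun s => cos (th s)) (fun s => sin (th s)) s.
Proof.
intros z0 dx dz_ dth; unfold frame_at, turning.
split; [exact z0 | split; [ | split; [exact dx | split; [exact dz_ | split]]]].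
- pose proof (sin2_cos2 (th s)); unfold Rsqr in *; lra.
- evar_last.
    apply (is_derive_comp cos th); [apply is_derive_Reals, derivable_pt_lim_cos | exact dth].
  unfold scal; simpl; unfold mult; simpl; ring.
- evar_last.
    apply (is_derive_comp sin th); [apply is_derive_Reals, derivable_pt_lim_sin | exact dth].
  unfold scal; simpl; unfold mult; simpl; ring.
Qed.

Lemma profile_frame (z0 : R) (x z th : R -> R) : profile z0 x z th ->
  forall s, frame_at x z (fun s => cos (th s)) (fun s => sin (th s)) s.
Proof.
intros [_ [_ [_ sol]]] s; destruct (sol s) as [p [d1 [d2 d3]]]; now apply angle_frame.
Qed.

(** * First integral and half period *)

Lemma profile_cos (z0 : R) (x z th : R -> R) (s : R) : profile z0 x z th ->
  cos (th s) = exp (2 * (potential (z s) - potential z0)).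
Proof.
intros pr; pose proof (profile_frame _ _ _ _ pr) as fr.
destruct pr as [_ [e [t _]]].
rewrite (first_integral always x z (fun s => cos (th s)) (fun s => sin (th s)) 0
  always_convex I (fun s _ => fr s) s I).
now rewrite t, cos_0, e, Rmult_1_l.
Qed.

Lemma profile_cos_pos (z0 : R) (x z th : R -> R) (s : R) : profile z0 x z th ->
  0 < cos (th s).
Proof. intros pr; rewrite (profile_cos _ _ _ _ s pr); apply exp_pos. Qed.

Lemma profile_cos_lower (z0 : R) (x z th : R -> R) (s : R) : profile z0 x z th ->
  exp (2 * (1 - potential z0)) <= cos (th s).
Proof.
intros pr; rewrite (profile_cos _ _ _ _ s pr); apply exp_le_exp.
destruct pr as [_ [_ [_ sol]]]; destruct (sol s) as [p _].
pose proof (potential_min _ p); lra.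
Qed.

(** The cosine never vanishes and the angle starts at 0. *)
Lemma profile_angle_bound (z0 : R) (x z th : R -> R) (s : R) : profile z0 x z th ->
  - (PI / 2) < th s < PI / 2.
Proof.
intros pr.
assert (ct : forall s, continuous th s).
  intros t; destruct pr as [_ [_ [_ sol]]]; destruct (sol t) as [_ [_ [_ d]]].
  eapply continuous_of_derive, d.
assert (t0 : th 0 = 0) by (destruct pr as [_ [_ [t _]]]; exact t).
assert (pi : 0 < PI) by apply PI_RGT_0.
assert (avoid : forall y, cos y = 0 -> forall s, th s <> y).
  intros y hy t e; pose proof (profile_cos_pos _ _ _ _ t pr) as p; rewrite e, hy in p; lra.
assert (cn : cos (- (PI / 2)) = 0) by (rewrite cos_neg; apply cos_PI2).
assert (cont : continuity th).
  intros t; apply continuity_pt_filterlim, ct.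
split.
- destruct (Rlt_or_le (- (PI / 2)) (th s)) as [l | l]; [exact l | exfalso].
  destruct (IVT_gen th 0 s (- (PI / 2)) cont) as [t [_ e]]; [ | now apply (avoid _ cn t)].
  rewrite t0, Rmin_right, Rmax_left; lra.
- destruct (Rlt_or_le (th s) (PI / 2)) as [l | l]; [exact l | exfalso].
  destruct (IVT_gen th 0 s (PI / 2) cont) as [t [_ e]]; [ | now apply (avoid _ cos_PI2 t)].
  rewrite t0, Rmin_left, Rmax_right; lra.
Qed.

(** While z <= 1 the sine of the angle does not decrease, so log z
    grows at least linearly and height 1 is crossed.  If the curve went on rising, the
    sine would from then on decrease at a rate bounded away from 0, and so reach 0. *)
Lemma profile_half_period (z0 : R) (x z th : R -> R) :
  0 < z0 < 1 -> profile z0 x z th ->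
  exists s1, 0 < s1 /\ sin (th s1) = 0 /\ forall s, 0 < s < s1 -> 0 < sin (th s).
Proof.
intros hz pr; pose proof (profile_frame _ _ _ _ pr) as fr.
pose proof pr as pr'; destruct pr' as [_ [e0 [t0 _]]].
set (sg s := sin (th s)).
assert (dsg : forall s, is_derive sg s (2 * cos (th s) ^ 2 * ((1 - z s) / z s))).
  intros s; destruct (fr s) as [_ [_ [_ [_ [_ d]]]]].
  evar_last; [exact d | unfold turning; simpl; ring].
assert (dz_ : forall s, is_derive z s (z s * sg s)).
  intros s; now destruct (fr s) as [_ [_ [_ [d _]]]].
assert (zpos : forall s, 0 < z s) by (intros s; now destruct (fr s)).
assert (dw : forall s, is_derive (fun s => ln (z s)) s (sg s)).
  intros s; evar_last.
    apply (is_derive_comp ln z); [apply is_derive_ln, zpos | apply dz_].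
  unfold scal; simpl; unfold mult; simpl; field; apply Rgt_not_eq, zpos.
assert (sg0 : sg 0 = 0) by (unfold sg; rewrite t0; apply sin_0).
assert (cpos := fun s => profile_cos_pos _ _ _ _ s pr).
assert (c2pos : forall s, 0 < 2 * cos (th s) ^ 2).
  intros s; pose proof (pow_lt _ 2 (cpos s)); lra.
assert (start : exists eps, 0 < eps /\ forall s, 0 < s <= eps -> 0 < sg s).
  assert (cz0 : continuous z 0) by (eapply continuous_of_derive, dz_).
  assert (p : 0 < 1 - z0) by lra.
  destruct (proj1 (filterlim_locally _ _) cz0 (mkposreal _ p)) as [d hd].
  exists (d / 2); pose proof (cond_pos d) as dpos; split; [lra | intros s hs].
  rewrite <- sg0.
  apply (derive_pos_lt sg (fun s => 2 * cos (th s) ^ 2 * ((1 - z s) / z s))); [lra | | ].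
    intros t _; apply dsg.
  intros t ht; apply Rmult_lt_0_compat; [apply c2pos | ].
  apply Rdiv_lt_0_compat; [ | apply zpos].
  specialize (hd t).
  change (Rabs (t - 0) < d -> Rabs (z t - z 0) < 1 - z0) in hd.
  rewrite Rminus_0_r, Rabs_pos_eq, e0 in hd by lra.
  specialize (hd ltac:(lra)); apply Rabs_def2 in hd; lra.
destruct start as [eps [eps0 start]].
assert (stop : exists b, eps <= b /\ sg b <= 0).
  apply Classical_Prop.NNPP; intros no.
  assert (pos : forall s, eps <= s -> 0 < sg s).
    intros s hs; destruct (Rlt_or_le 0 (sg s)) as [p | n]; [exact p | ].
    exfalso; apply no; now exists s.
  assert (mono : forall a b, eps <= a -> a <= b -> z a <= z b).
    intros a b ha hab.
    apply (derive_nonneg_le z (fun s => z s * sg s)); [exact hab | intros; apply dz_ | ].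
    intros s hs; apply Rmult_le_pos; apply Rlt_le; [apply zpos | apply pos; lra].
  (* As long as the curve is below height 1 it turns upwards, so ln z grows at
     least linearly and height 1 is crossed. *)
  assert (cross : exists a, eps <= a /\ 1 < z a).
    apply Classical_Prop.NNPP; intros nc.
    assert (low : forall s, eps <= s -> z s <= 1).
      intros s hs; destruct (Rle_or_lt (z s) 1) as [l | l]; [exact l | ].
      exfalso; apply nc; now exists s.
    assert (sgl : forall s, eps <= s -> sg eps <= sg s).
      intros s hs; apply (derive_nonneg_le sg (fun s => 2 * cos (th s) ^ 2 * ((1 - z s) / z s)));
        [exact hs | intros; apply dsg | ].
      intros t ht; apply Rmult_le_pos; [apply Rlt_le, c2pos | ].
      apply Rmult_le_pos; [specialize (low t); lra | apply Rlt_le, Rinv_0_lt_compat, zpos].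
    pose proof (pos eps (Rle_refl eps)) as pe.
    set (b := eps + (1 - ln (z eps)) / sg eps).
    assert (le : ln (z eps) <= 0).
      rewrite <- ln_1; apply Rcomplements.ln_le; [apply zpos | apply low; lra].
    assert (eb : eps <= b).
      assert (0 <= (1 - ln (z eps)) / sg eps); [ | unfold b; lra].
      apply Rmult_le_pos; [lra | apply Rlt_le, Rinv_0_lt_compat, pe].
    assert (h : ln (z eps) - sg eps * eps <= ln (z b) - sg eps * b).
      apply (derive_nonneg_le (fun s => ln (z s) - sg eps * s) (fun s => sg s - sg eps)).
      - exact eb.
      - intros s hs; apply (is_derive_minus (V := R_NormedModule)); [apply dw | ].
        auto_derive; [exact I | ring].
      - intros s hs; specialize (sgl s); lra.
    assert (lb : ln (z b) <= 0).
      rewrite <- ln_1; apply Rcomplements.ln_le; [apply zpos | apply low; lra].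
    assert (sg eps * b = sg eps * eps + (1 - ln (z eps))) by (unfold b; field; lra).
    lra.
  destruct cross as [a [ha za]].
  (* Above height 1 it turns downwards at a rate bounded below. *)
  set (m := exp (2 * (1 - potential z0))).
  assert (m0 : 0 < m) by apply exp_pos.
  set (eta := 2 * m ^ 2 * ((z a - 1) / z a)).
  assert (eta0 : 0 < eta).
    apply Rmult_lt_0_compat; [pose proof (pow_lt _ 2 m0); lra | ].
    apply Rdiv_lt_0_compat; lra.
  set (b := a + 2 / eta).
  assert (ab : a <= b).
    assert (0 < 2 / eta) by (apply Rdiv_lt_0_compat; lra); unfold b; lra.
  assert (h : - sg a - eta * a <= - sg b - eta * b).
    apply (derive_nonneg_le (fun s => - sg s - eta * s)
      (fun s => - (2 * cos (th s) ^ 2 * ((1 - z s) / z s)) - eta)).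
    - exact ab.
    - intros s hs; apply (is_derive_minus (V := R_NormedModule)).
        apply (is_derive_opp (V := R_NormedModule)), dsg.
      auto_derive; [exact I | ring].
    - intros s hs.
      assert (hh : eta <= 2 * cos (th s) ^ 2 * ((z s - 1) / z s)).
        apply Rmult_le_compat.
        + pose proof (pow_lt _ 2 m0); lra.
        + apply Rlt_le, Rdiv_lt_0_compat; lra.
        + apply Rmult_le_compat_l; [lra | ].
          apply pow_incr; split; [lra | apply (profile_cos_lower _ x z th s pr)].
        + assert (zs : z a <= z s) by (apply mono; lra).
          replace ((z a - 1) / z a) with (1 - / z a) by (field; lra).
          replace ((z s - 1) / z s) with (1 - / z s) by (field; lra).
          pose proof (Rinv_le_contravar (z a) (z s)); lra.
      replace ((1 - z s) / z s) with (- ((z s - 1) / z s)) by (field; apply Rgt_not_eq, zpos).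
      lra.
  assert (eta * b = eta * a + 2) by (unfold b; field; lra).
  assert (sg a <= 1) by (unfold sg; pose proof (SIN_bound (th a)); lra).
  specialize (pos b); lra.
destruct stop as [b [hb sb]].
destruct (first_zero sg eps b hb) as [s1 [h1 [h2 h3]]].
- intros s _; eapply continuous_of_derive, dsg.
- apply start; lra.
- exact sb.
- exists s1; split; [lra | split; [exact h2 | ]].
  intros s hs; destruct (Rle_or_lt s eps) as [l | l]; [apply start; lra | apply h3; lra].
Qed.

(** * Reflections, heights and the periodic graph *)

(** At a horizontal tangent the solution and its reversal reflected in x
    have the same initial data. *)
Lemma profile_reflection (z0 : R) (x z th : R -> R) (t : R) :
  profile z0 x z th -> sin (th t) = 0 ->
  forall s, z (2 * t - s) = z s /\ sin (th (2 * t - s)) = - sin (th s) /\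
    x (2 * t - s) = 2 * x t - x s.
Proof.
intros pr st s; pose proof (profile_frame _ _ _ _ pr) as fr.
destruct (frame_unique always _ _ _ _ _ _ _ _ t always_convex I (fun s _ => fr s)
  (fun s _ => frame_symmetry _ _ _ _ 0 1 (-1) (2 * t) s (or_introl eq_refl)
    (or_intror eq_refl) (fr (2 * t + -1 * s)))) with (s := s) as [e1 [e2 [e3 e4]]];
  try exact I; simpl in *;
  try replace (2 * t + -1 * t) with t by ring; try rewrite st; try ring.
replace (2 * t + -1 * s) with (2 * t - s) in * by ring.
replace (2 * t + -1 * t) with t in * by ring.
split; [symmetry; exact e1 | split; lra].
Qed.

Lemma profile_even (z0 : R) (x z th : R -> R) :
  profile z0 x z th -> forall s, z (- s) = z s /\ x (- s) = - x s.
Proof.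
intros pr s.
assert (st : sin (th 0) = 0) by (destruct pr as [_ [_ [-> _]]]; apply sin_0).
destruct (profile_reflection _ _ _ _ 0 pr st s) as [e1 [_ e2]].
replace (2 * 0 - s) with (- s) in * by ring.
destruct pr as [x0 _]; rewrite x0 in e2; split; [exact e1 | lra].
Qed.

Lemma profile_pos (z0 : R) (x z th : R -> R) (s : R) : profile z0 x z th -> 0 < z s.
Proof. intros [_ [_ [_ sol]]]; now destruct (sol s). Qed.

Lemma profile_dx (z0 : R) (x z th : R -> R) (s : R) : profile z0 x z th ->
  is_derive x s (z s * cos (th s)).
Proof. intros [_ [_ [_ sol]]]; now destruct (sol s) as [_ [d _]]. Qed.

Lemma profile_dz (z0 : R) (x z th : R -> R) (s : R) : profile z0 x z th ->
  is_derive z s (z s * sin (th s)).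
Proof. intros [_ [_ [_ sol]]]; now destruct (sol s) as [_ [_ [d _]]]. Qed.

Lemma profile_dth (z0 : R) (x z th : R -> R) (s : R) : profile z0 x z th ->
  is_derive th s (2 * cos (th s) * ((1 - z s) / z s)).
Proof. intros [_ [_ [_ sol]]]; now destruct (sol s) as [_ [_ [_ d]]]. Qed.

Definition half_period (th : R -> R) (s1 : R) : Prop :=
  0 < s1 /\ sin (th s1) = 0 /\ forall s, 0 < s < s1 -> 0 < sin (th s).

Lemma profile_potential_le (z0 : R) (x z th : R -> R) (s : R) : profile z0 x z th ->
  potential (z s) <= potential z0.
Proof.
intros pr; pose proof (profile_cos _ _ _ _ s pr) as e; pose proof (COS_bound (th s)) as b.
destruct (Rle_or_lt (potential (z s)) (potential z0)) as [l | l]; [exact l | ].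
assert (exp 0 < exp (2 * (potential (z s) - potential z0))) by (apply exp_increasing; lra).
rewrite exp_0 in H; lra.
Qed.

Lemma profile_increasing (z0 : R) (x z th : R -> R) (s1 a b : R) :
  profile z0 x z th -> half_period th s1 -> 0 <= a -> a < b -> b <= s1 -> z a < z b.
Proof.
intros pr [_ [_ up]] ha hab hb.
apply (derive_pos_lt z (fun s => z s * sin (th s))); [exact hab | | ].
- intros s _; apply (profile_dz _ _ _ _ s pr).
- intros s hs; apply Rmult_lt_0_compat; [apply (profile_pos _ _ _ _ s pr) | apply up; lra].
Qed.

(** At the end of the half period the tangent is horizontal, so the potential
    has its initial value again, now on the other side of 1. *)
Lemma profile_top (z0 : R) (x z th : R -> R) (s1 : R) :
  0 < z0 < 1 -> profile z0 x z th -> half_period th s1 ->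
  1 < z s1 /\ potential (z s1) = potential z0 /\ forall s, z0 <= z s <= z s1.
Proof.
intros hz pr hp; pose proof hp as [s10 [st up]].
assert (e0 : z 0 = z0) by now destruct pr as [_ [e _]].
assert (ep : potential (z s1) = potential z0).
  pose proof (profile_cos _ _ _ _ s1 pr) as e.
  pose proof (profile_cos_pos _ _ _ _ s1 pr) as p.
  pose proof (sin2_cos2 (th s1)) as u; unfold Rsqr in u; rewrite st in u.
  assert (c1 : cos (th s1) = 1) by nra.
  rewrite c1, <- exp_0 in e; apply exp_inv in e; lra.
assert (l : z0 < z s1).
  rewrite <- e0; apply (profile_increasing z0 x z th s1); trivial; lra.
assert (h1 : 1 < z s1).
  destruct (Rlt_or_le 1 (z s1)) as [h | h]; [exact h | exfalso].
  assert (z s1 = z0); [ | lra].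
  apply potential_inj_low; [lra | lra | exact ep].
split; [exact h1 | split; [exact ep | intros s]].
pose proof (profile_potential_le _ _ _ _ s pr) as le.
pose proof (profile_pos _ _ _ _ s pr) as p.
split.
- destruct (Rle_or_lt z0 (z s)) as [h | h]; [exact h | exfalso].
  pose proof (potential_decreasing (z s) z0); lra.
- destruct (Rle_or_lt (z s) (z s1)) as [h | h]; [exact h | exfalso].
  pose proof (potential_increasing (z s1) (z s)); lra.
Qed.

Lemma profile_inverse (z0 : R) (x z th : R -> R) :
  0 < z0 < 1 -> profile z0 x z th ->
  exists xi, (forall s, xi (x s) = s) /\ (forall y, x (xi y) = y) /\
    forall y, is_derive xi y (/ (z (xi y) * cos (th (xi y)))).
Proof.
intros hz pr.
destruct (profile_half_period _ _ _ _ hz pr) as [s1 hp].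
destruct (profile_top _ _ _ _ _ hz pr hp) as [_ [_ zb]].
apply (inverse_of_steep x (fun s => z s * cos (th s)) (z0 * exp (2 * (1 - potential z0)))).
- apply Rmult_lt_0_compat; [lra | apply exp_pos].
- intros s; apply (profile_dx _ _ _ _ s pr).
- intros s; apply (continuous_mult (K := R_AbsRing)).
  + exact (continuous_of_derive _ _ _ (profile_dz _ _ _ _ s pr)).
  + apply (continuous_comp th cos); [ | apply continuous_cos].
    exact (continuous_of_derive _ _ _ (profile_dth _ _ _ _ s pr)).
- intros s; apply Rmult_le_compat; [lra | apply Rlt_le, exp_pos | apply zb | ].
  apply (profile_cos_lower _ _ _ _ s pr).
Qed.

(** Along the graph, z, 1/z, c, 1/c, sg as functions of x generate an
    algebra closed under differentiation. *)
Lemma profile_graph_smooth (z0 : R) (x z th xi : R -> R) :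
  profile z0 x z th ->
  (forall y, is_derive xi y (/ (z (xi y) * cos (th (xi y))))) ->
  forall y, smooth_at (fun y => z (xi y)) y.
Proof.
intros pr dxi.
set (u y := z (xi y)); set (v y := / z (xi y)).
set (c y := cos (th (xi y))); set (k y := / cos (th (xi y))); set (sg y := sin (th (xi y))).
set (gen f := f = u \/ f = v \/ f = c \/ f = k \/ f = sg).
assert (gu : algebra gen u) by (apply alg_gen; unfold gen; tauto).
assert (gv : algebra gen v) by (apply alg_gen; unfold gen; tauto).
assert (gc : algebra gen c) by (apply alg_gen; unfold gen; tauto).
assert (gk : algebra gen k) by (apply alg_gen; unfold gen; tauto).
assert (gs : algebra gen sg) by (apply alg_gen; unfold gen; tauto).
assert (comp : forall f l y, is_derive f (xi y) l ->
  is_derive (fun y => f (xi y)) y (l * v y * k y)).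
  intros f l y df; evar_last; [apply (is_derive_comp f xi y _ _ df (dxi y)) | ].
  unfold scal, v, k; simpl; unfold mult; simpl.
  pose proof (profile_pos _ _ _ _ (xi y) pr); pose proof (profile_cos_pos _ _ _ _ (xi y) pr).
  field; lra.
apply algebra_smooth with gen; [ | exact gu].
assert (frc : forall y, is_derive c y (-2 * sg y * (v y + -1) * v y)).
  intros y; destruct (profile_frame _ _ _ _ pr (xi y)) as [p [_ [_ [_ [d _]]]]].
  pose proof (profile_cos_pos _ _ _ _ (xi y) pr).
  evar_last; [exact (comp _ _ y d) | unfold turning, v, k, sg; field; lra].
intros f [-> | [-> | [-> | [-> | ->]]]].
- exists (fun y => sg y * k y); split; [now apply alg_mult | intros y].
  pose proof (profile_pos _ _ _ _ (xi y) pr).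
  evar_last; [exact (comp _ _ y (profile_dz _ _ _ _ (xi y) pr)) | ].
  unfold v, k, sg; field; split; [ | lra].
  apply Rgt_not_eq, (profile_cos_pos _ _ _ _ (xi y) pr).
- exists (fun y => -1 * (v y * v y * sg y * k y)); split.
    repeat first [exact gv | exact gs | exact gk | apply alg_mult | apply alg_const].
  intros y; evar_last.
    exact (comp _ _ y (frame_inv_derive _ _ _ _ _ (profile_frame _ _ _ _ pr (xi y)))).
  unfold v, k, sg; ring.
- exists (fun y => -2 * sg y * (v y + -1) * v y); split; [ | exact frc].
  repeat first [exact gv | exact gs | apply alg_mult | apply alg_plus | apply alg_const].
- exists (fun y => 2 * sg y * (v y + -1) * v y * k y * k y); split.
    repeat first [exact gv | exact gs | exact gk | apply alg_mult | apply alg_plus | apply alg_const].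
  intros y; pose proof (profile_cos_pos _ _ _ _ (xi y) pr).
  evar_last; [apply (is_derive_inv c y _ (frc y)); unfold c; lra | ].
  unfold k, c; field; lra.
- exists (fun y => 2 * c y * (v y + -1) * v y); split.
    repeat first [exact gv | exact gc | apply alg_mult | apply alg_plus | apply alg_const].
  intros y; destruct (profile_frame _ _ _ _ pr (xi y)) as [p [_ [_ [_ [_ d]]]]].
  pose proof (profile_cos_pos _ _ _ _ (xi y) pr).
  evar_last; [exact (comp _ _ y d) | unfold turning, v, k, c; field; lra].
Qed.

Lemma profile_periodic_graph (z0 : R) (x z th : R -> R) :
  0 < z0 < 1 -> profile z0 x z th ->
  exists u T, entire_graph (complete_curve x z) u /\ 0 < T /\ forall y, u (y + T) = u y.
Proof.
intros hz pr.
destruct (profile_half_period _ _ _ _ hz pr) as [s1 hp].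
pose proof hp as [s10 [st _]].
destruct (profile_inverse _ _ _ _ hz pr) as [xi [xi_x [x_xi dxi]]].
exists (fun y => z (xi y)), (2 * x s1); split; [split; [ | split] | split].
- apply (profile_graph_smooth _ _ _ _ _ pr dxi).
- intros a b _ _ e; simpl in e; rewrite <- (xi_x a), <- (xi_x b); now f_equal.
- intros [p1 p2 p3]; split.
  + intros [s [t [_ e]]]; injection e as -> -> ->; simpl; now rewrite xi_x.
  + intros e; simpl in e; exists (xi p1), p2; split; [split; exact I | ].
    unfold ruled; simpl; now rewrite x_xi, e.
- assert (h : x 0 < x s1).
    apply (derive_pos_lt x (fun s => z s * cos (th s))); [exact s10 | | ].
    + intros s _; apply (profile_dx _ _ _ _ s pr).
    + intros s _; apply Rmult_lt_0_compat;
        [apply (profile_pos _ _ _ _ s pr) | apply (profile_cos_pos _ _ _ _ s pr)].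
  destruct pr as [x0 _]; rewrite x0 in h; lra.
- intros y; rewrite <- (x_xi y) at 1.
  set (s := xi y).
  destruct (profile_reflection _ _ _ _ s1 pr st (- s)) as [e1 [_ e2]].
  destruct (profile_even _ _ _ _ pr s) as [e3 e4].
  replace (x s + 2 * x s1) with (x (2 * s1 - - s)) by (rewrite e2, e4; ring).
  now rewrite xi_x, e1, e3.
Qed.

(** * Limits of the family *)

Lemma at_right_0_intro (P : R -> Prop) (rho : R) :
  0 < rho -> (forall y, 0 < y < rho -> P y) -> at_right 0 P.
Proof.
intros r0 h; exists (mkposreal _ r0); intros y hy y0.
change (Rabs (y - 0) < rho) in hy; rewrite Rminus_0_r in hy.
apply h; split; [exact y0 | ]; apply Rle_lt_trans with (2 := hy), Rle_abs.
Qed.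

Lemma at_left_1_intro (P : R -> Prop) (rho : R) :
  0 < rho -> (forall y, 1 - rho < y < 1 -> P y) -> at_left 1 P.
Proof.
intros r0 h; exists (mkposreal _ r0); intros y hy y1.
change (Rabs (y - 1) < rho) in hy; apply Rabs_def2 in hy.
apply h; lra.
Qed.

Lemma edist_horizontal (a b t c : R) : edist (V3 a t c) (V3 b t c) = Rabs (a - b).
Proof.
unfold edist, dot, vadd, vscal; simpl.
rewrite <- sqrt_Rsqr_abs; f_equal; unfold Rsqr; ring.
Qed.

Lemma edist_vertical (a t c d : R) : edist (V3 a t c) (V3 a t d) = Rabs (c - d).
Proof.
unfold edist, dot, vadd, vscal; simpl.
rewrite <- sqrt_Rsqr_abs; f_equal; unfold Rsqr; ring.
Qed.

Lemma potential_blowup (E : R) :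
  exists rho, 0 < rho <= 1 /\ forall z, 0 < z < rho -> E < potential z.
Proof.
pose proof (Rabs_pos E) as E0; pose proof (Rle_abs E) as E1.
exists (/ (2 * (Rabs E + 1))); split; [split | ].
- apply Rinv_0_lt_compat; lra.
- rewrite <- Rinv_1; apply Rinv_le_contravar; lra.
- intros z [z0 zr].
  apply Rlt_le_trans with (2 := potential_lower z z0).
  apply Rle_lt_trans with (Rabs E + 1 - 1); [lra | ].
  assert (h : (Rabs E + 1) * 2 * z < 1).
    apply Rmult_lt_reg_r with (/ (2 * (Rabs E + 1))); [apply Rinv_0_lt_compat; lra | ].
    replace ((Rabs E + 1) * 2 * z * / (2 * (Rabs E + 1))) with z by (field; lra); lra.
  apply Rmult_lt_reg_r with (2 * z); [lra | ].
  rewrite Rinv_l by lra; nra.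
Qed.

Lemma potential_continuous_at_1 (eps : R) :
  0 < eps -> exists rho, 0 < rho <= 1 /\
    forall z, 1 - rho < z < 1 -> potential z < potential (1 + eps).
Proof.
intros e0.
assert (p : 0 < potential (1 + eps) - 1).
  pose proof (potential_gt_1 (1 + eps)); lra.
destruct (proj1 (filterlim_locally _ _) (potential_continuous 1 Rlt_0_1) (mkposreal _ p)) as [d hd].
exists (Rmin d 1); pose proof (cond_pos d).
pose proof (Rmin_l d 1); pose proof (Rmin_r d 1).
split; [split; [apply Rmin_glb_lt; lra | lra] | intros z hz].
specialize (hd z).
change (Rabs (z - 1) < d -> Rabs (potential z - potential 1) < potential (1 + eps) - 1) in hd.
rewrite Rabs_left, potential_1 in hd by lra.
specialize (hd ltac:(lra)); apply Rabs_def2 in hd; lra.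
Qed.

Lemma height_lt_of_potential (h k : R) :
  1 <= h -> 1 <= k -> potential h < potential k -> h < k.
Proof.
intros h1 k1 l; destruct (Rlt_or_le h k) as [p | [p | ->]]; [exact p | | lra].
pose proof (potential_increasing k h); lra.
Qed.

Lemma potential_le_on_segment (d r zt : R) :
  0 < d -> d <= zt <= r -> potential zt <= potential d + potential r.
Proof.
intros d0 h.
pose proof (potential_min d d0); assert (r0 : 0 < r) by lra.
pose proof (potential_min r r0).
destruct (Rle_or_lt 1 zt) as [l | l].
- destruct (Req_dec zt r) as [-> | n]; [lra | ].
  pose proof (potential_increasing zt r); lra.
- destruct (Req_dec zt d) as [-> | n]; [lra | ].
  pose proof (potential_decreasing d zt); lra.
Qed.

Lemma half_period_angle (z0 : R) (x z th : R -> R) (s1 s : R) :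
  profile z0 x z th -> half_period th s1 -> 0 <= s <= s1 ->
  0 <= sin (th s) /\ 0 <= th s < PI / 2.
Proof.
intros pr [s10 [st up]] hs.
assert (sp : 0 <= sin (th s)).
  destruct (Req_dec s s1) as [-> | n]; [lra | ].
  destruct (Req_dec s 0) as [-> | n'].
    destruct pr as [_ [_ [-> _]]]; rewrite sin_0; lra.
  apply Rlt_le, up; lra.
split; [exact sp | ].
pose proof (profile_angle_bound _ _ _ _ s pr) as [b1 b2].
split; [ | exact b2].
destruct (Rle_or_lt 0 (th s)) as [l | l]; [exact l | exfalso].
assert (sin (th s) < 0) by (apply sin_lt_0_var; lra).
lra.
Qed.

Lemma ascent_reaches (z0 : R) (x z th : R -> R) (s1 zt : R) :
  profile z0 x z th -> half_period th s1 -> z0 <= zt <= z s1 ->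
  exists s, 0 <= s <= s1 /\ z s = zt.
Proof.
intros pr [s10 _] hz.
apply (ivt_segment z 0 s1); [lra | | ].
- intros s _; exact (continuous_of_derive _ _ _ (profile_dz _ _ _ _ s pr)).
- now destruct pr as [_ [-> _]].
Qed.

(** The drift is at most d below height d, where x changes slowly with respect
    to the angle, and at most 2 eta r between d and r, where the slope dx/dz is at
    most 2 eta. *)
Lemma ascent_drift (z0 : R) (x z th : R -> R) (s1 d eta r s : R) :
  profile z0 x z th -> half_period th s1 -> z0 <= d <= 1 / 2 -> 0 < eta <= 1 / 2 -> 0 < r ->
  (forall zt, d <= zt <= r -> exp (2 * (potential zt - potential z0)) <= eta) ->
  0 <= s <= s1 -> z s <= r ->
  x s <= d + 2 * eta * r.
Proof.
intros pr hp hd heta r0 small hs zr.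
assert (e0 : z 0 = z0) by now destruct pr as [_ [e _]].
assert (zp := fun s => profile_pos _ _ _ _ s pr).
assert (cp := fun s => profile_cos_pos _ _ _ _ s pr).
pose proof (zp 0) as z00; rewrite e0 in z00.
assert (mono : forall a b, 0 <= a -> a <= b -> b <= s1 -> z a <= z b).
  intros a b ha [hab | ->] hb; [ | lra].
  apply Rlt_le, (profile_increasing _ _ _ _ _ _ _ pr hp); assumption.
assert (low : forall a, 0 <= a <= s1 -> z a <= d -> x a <= d).
  intros a ha za.
  (* With respect to the angle, x has slope z^2 / (2 (1 - z)) <= d^2. *)
  assert (h : d ^ 2 * th 0 - x 0 <= d ^ 2 * th a - x a).
    apply (derive_nonneg_le (fun s => d ^ 2 * th s - x s)
      (fun s => d ^ 2 * (2 * cos (th s) * ((1 - z s) / z s)) - z s * cos (th s))); [lra | | ].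
    - intros t _; apply (is_derive_minus (V := R_NormedModule)).
        apply (is_derive_scal th), (profile_dth _ _ _ _ t pr).
      apply (profile_dx _ _ _ _ t pr).
    - intros t ht.
      assert (zt : z t <= d) by (apply Rle_trans with (2 := za), mono; lra).
      replace (d ^ 2 * (2 * cos (th t) * ((1 - z t) / z t)) - z t * cos (th t))
        with (cos (th t) * ((2 * d ^ 2 * (1 - z t) - z t ^ 2) / z t))
        by (field; apply Rgt_not_eq, zp).
      apply Rmult_le_pos; [apply Rlt_le, cp | ].
      apply Rmult_le_pos; [ | apply Rlt_le, Rinv_0_lt_compat, zp].
      pose proof (zp t); nra.
  destruct pr as [x0 [_ [t0 sol]]]; rewrite x0, t0 in h.
  assert (pr : profile z0 x z th) by (unfold profile; tauto).
  pose proof (profile_angle_bound _ _ _ _ a pr) as [_ b].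
  pose proof PI_4 as p4; nra.
assert (d0 : 0 < d) by lra.
destruct (Rle_or_lt (z s) d) as [l | l].
  specialize (low s hs l).
  assert (0 <= 2 * eta * r) by (apply Rmult_le_pos; lra); lra.
destruct (ascent_reaches _ _ _ _ s1 d pr hp) as [a [ha za]].
  split; [lra | ].
  apply Rle_trans with (z s); [lra | apply mono; lra].
assert (as_ : a < s).
  destruct (Rlt_or_le a s) as [h | h]; [exact h | exfalso].
  assert (z s <= z a) by (apply mono; lra); lra.
specialize (low a ha ltac:(lra)).
(* Above height d the tangent is nearly vertical: the cosine is at most eta and
   the sine at least 1/2. *)
assert (h : 2 * eta * z a - x a <= 2 * eta * z s - x s).
  apply (derive_nonneg_le (fun s => 2 * eta * z s - x s)
    (fun s => 2 * eta * (z s * sin (th s)) - z s * cos (th s))); [lra | | ].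
  - intros t _; apply (is_derive_minus (V := R_NormedModule)).
      apply (is_derive_scal z), (profile_dz _ _ _ _ t pr).
    apply (profile_dx _ _ _ _ t pr).
  - intros t ht.
    assert (z1 : d <= z t) by (rewrite <- za; apply mono; lra).
    assert (z2 : z t <= r) by (apply Rle_trans with (2 := zr), mono; lra).
    pose proof (small (z t) (conj z1 z2)) as ce.
    rewrite <- (profile_cos _ _ _ _ t pr) in ce.
    destruct (half_period_angle _ _ _ _ s1 t pr hp ltac:(lra)) as [sp _].
    pose proof (sin2_cos2 (th t)) as u; unfold Rsqr in u.
    pose proof (cp t); pose proof (zp t).
    assert (1 / 2 <= sin (th t)) by nra.
    replace (2 * eta * (z t * sin (th t)) - z t * cos (th t))
      with (z t * (2 * eta * sin (th t) - cos (th t))) by ring.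
    apply Rmult_le_pos; nra.
assert (2 * eta * z s <= 2 * eta * r) by (apply Rmult_le_compat_l; lra).
assert (0 <= 2 * eta * z a) by (apply Rmult_le_pos; [ | specialize (zp a)]; lra).
lra.
Qed.

(** At height k the cosine is below 1/2 and the angle above 1; it returns
    to 0 above height k, at a rate of at most 2/k with respect to x. *)
Lemma half_width_lower (z0 : R) (x z th : R -> R) (s1 k : R) :
  0 < z0 < 1 -> profile z0 x z th -> half_period th s1 -> 1 < k ->
  potential k + 1 < potential z0 -> k / 2 <= x s1.
Proof.
intros hz pr hp k1 tall.
destruct (profile_top _ _ _ _ _ hz pr hp) as [zt [ep _]].
assert (kz : k < z s1) by (apply height_lt_of_potential; lra).
destruct (ascent_reaches _ _ _ _ s1 k pr hp) as [a [ha za]]; [lra | ].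
assert (x0 : x 0 = 0) by now destruct pr.
assert (zp := fun s => profile_pos _ _ _ _ s pr).
assert (cp := fun s => profile_cos_pos _ _ _ _ s pr).
assert (xa : 0 <= x a).
  rewrite <- x0; apply (derive_nonneg_le x (fun s => z s * cos (th s))); [lra | | ].
  - intros t _; apply (profile_dx _ _ _ _ t pr).
  - intros t _; apply Rmult_le_pos; apply Rlt_le; [apply zp | apply cp].
assert (tha : 1 <= th a).
  assert (ca : cos (th a) < 1 / 2).
    rewrite (profile_cos _ _ _ _ a pr), za.
    apply Rlt_trans with (exp (Ropp 2)); [apply exp_increasing; lra | ].
    rewrite exp_Ropp; apply Rmult_lt_reg_r with (exp 2); [apply exp_pos | ].
    rewrite Rinv_l by apply Rgt_not_eq, exp_pos.
    pose proof (exp_ineq1 2); lra.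
  destruct (half_period_angle _ _ _ _ s1 a pr hp ha) as [_ b].
  destruct (Rle_or_lt 1 (th a)) as [l | l]; [exact l | exfalso].
  assert (1 < PI / 3) by (pose proof PI2_3_2; lra).
  assert (cos (PI / 3) <= cos (th a)); [ | rewrite cos_PI3 in H0; lra].
  apply cos_decr_1; lra.
(* Above height k the angle turns back at rate at most 2 / k with respect to x. *)
assert (h : x a + k / 2 * th a <= x s1 + k / 2 * th s1).
  apply (derive_nonneg_le (fun s => x s + k / 2 * th s)
    (fun s => z s * cos (th s) + k / 2 * (2 * cos (th s) * ((1 - z s) / z s)))); [lra | | ].
  - intros t _; apply (is_derive_plus (V := R_NormedModule)); [apply (profile_dx _ _ _ _ t pr) | ].
    apply (is_derive_scal th), (profile_dth _ _ _ _ t pr).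
  - intros t ht.
    assert (kt : k <= z t).
      destruct (Req_dec a t) as [<- | n]; [lra | ].
      rewrite <- za; apply Rlt_le, (profile_increasing _ _ _ _ _ _ _ pr hp); lra.
    replace (z t * cos (th t) + k / 2 * (2 * cos (th t) * ((1 - z t) / z t)))
      with (cos (th t) * ((z t ^ 2 + k * (1 - z t)) / z t)) by (field; apply Rgt_not_eq, zp).
    apply Rmult_le_pos; [apply Rlt_le, cp | ].
    apply Rmult_le_pos; [nra | apply Rlt_le, Rinv_0_lt_compat, zp].
assert (th1 : th s1 = 0).
  destruct (half_period_angle _ _ _ _ s1 s1 pr hp ltac:(lra)) as [_ [b1 b2]].
  destruct hp as [_ [st _]]; destruct b1 as [b1 | b1]; [exfalso | now symmetry].
  assert (0 < sin (th s1)) by (apply sin_gt_0; lra); lra.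
rewrite th1 in h.
assert (k / 2 * 1 <= k / 2 * th a) by (apply Rmult_le_compat_l; lra).
lra.
Qed.

(** The quantitative form of the collapse: in a compact set of size r only the
    first ascent is visible, it covers all heights up to r, and it is eps-close to x = 0. *)
Lemma thin_ascent (r eps : R) : 0 < r -> 0 < eps ->
  exists rho, 0 < rho <= 1 /\ forall z0 x z th s1, 0 < z0 < rho -> profile z0 x z th ->
    half_period th s1 ->
    z0 <= / r /\ r < x s1 /\ r < z s1 /\
    forall s, 0 <= s <= s1 -> z s <= r -> 0 <= x s < eps.
Proof.
intros r0 e0.
set (d := Rmin (1 / 2) (eps / 4)).
assert (d0 : 0 < d) by (apply Rmin_glb_lt; lra).
pose proof (Rmin_l (1 / 2) (eps / 4)) as d1; pose proof (Rmin_r (1 / 2) (eps / 4)) as d2.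
fold d in d1, d2.
set (eta := Rmin (1 / 2) (eps / (8 * r))).
assert (q0 : 0 < eps / (8 * r)) by (apply Rdiv_lt_0_compat; lra).
assert (eta0 : 0 < eta) by (apply Rmin_glb_lt; lra).
pose proof (Rmin_l (1 / 2) (eps / (8 * r))) as eta1.
pose proof (Rmin_r (1 / 2) (eps / (8 * r))) as eta2; fold eta in eta1, eta2.
set (k := 2 * r + 2).
destruct (potential_blowup (Rmax (potential k + 1) (potential d + potential r - ln eta / 2)))
  as [rho [hr tall]].
assert (ir : 0 < / r) by now apply Rinv_0_lt_compat.
exists (Rmin (Rmin rho d) (/ r)).
pose proof (Rmin_l (Rmin rho d) (/ r)) as m1; pose proof (Rmin_r (Rmin rho d) (/ r)) as m2.
pose proof (Rmin_l rho d) as m3; pose proof (Rmin_r rho d) as m4.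
split; [split; [repeat apply Rmin_glb_lt | ]; lra | ].
intros z0 x z th s1 hz pr hp.
assert (hz' : 0 < z0 < 1) by lra.
specialize (tall z0 ltac:(lra)).
pose proof (Rmax_l (potential k + 1) (potential d + potential r - ln eta / 2)) as t1.
pose proof (Rmax_r (potential k + 1) (potential d + potential r - ln eta / 2)) as t2.
assert (wide : k / 2 <= x s1).
  apply (half_width_lower z0 x z th s1 k hz' pr hp); unfold k in *; lra.
destruct (profile_top _ _ _ _ _ hz' pr hp) as [zt [ep _]].
assert (high : k < z s1) by (apply height_lt_of_potential; unfold k in *; lra).
split; [lra | split; [unfold k in wide; lra | split; [unfold k in high; lra | ]]].
intros s hs zs; split.
- assert (x0 : x 0 = 0) by now destruct pr.
  rewrite <- x0; apply (derive_nonneg_le x (fun s => z s * cos (th s))); [lra | | ].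
  + intros t _; apply (profile_dx _ _ _ _ t pr).
  + intros t _; apply Rmult_le_pos; apply Rlt_le;
      [apply (profile_pos _ _ _ _ t pr) | apply (profile_cos_pos _ _ _ _ t pr)].
- apply Rle_lt_trans with (d + 2 * eta * r).
  + apply (ascent_drift z0 x z th s1 d eta r s pr hp); try lra.
    intros zt' hzt.
    pose proof (potential_le_on_segment d r zt' d0 hzt).
    rewrite <- (exp_ln eta eta0).
    apply exp_le_exp; lra.
  + assert (eta * r <= eps / (8 * r) * r) by (apply Rmult_le_compat_r; lra).
    replace (eps / (8 * r) * r) with (eps / 8) in H by (field; lra); lra.
Qed.

(** The sign e = 1 gives the part of the surface with s >= 0 and e = -1 its mirror
    image, which by evenness of z is the part with s <= 0; both limits are treated at once. *)
Definition branch (e : R) (x z : R -> R) (p : vec3) : Prop :=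
  exists s t, 0 <= s /\ p = V3 (e * x s) t (z s).

Lemma branch_ascent (z0 : R) (x z th : R -> R) (s1 r s : R) :
  profile z0 x z th -> half_period th s1 -> r < x s1 -> 0 <= s -> x s <= r -> 0 <= s <= s1.
Proof.
intros pr hp wide s0 xs; split; [exact s0 | ].
destruct (Rle_or_lt s s1) as [l | l]; [exact l | exfalso].
assert (x s1 < x s); [ | lra].
apply (derive_pos_lt x (fun s => z s * cos (th s))); [exact l | | ].
- intros t _; apply (profile_dx _ _ _ _ t pr).
- intros t _; apply Rmult_lt_0_compat;
    [apply (profile_pos _ _ _ _ t pr) | apply (profile_cos_pos _ _ _ _ t pr)].
Qed.

Definition profile_family (X Z TH : R -> R -> R) : Prop :=
  forall z0, 0 < z0 < 1 -> profile z0 (X z0) (Z z0) (TH z0).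

Lemma sign_abs (e a : R) : e = 1 \/ e = -1 -> Rabs (e * a) = Rabs a.
Proof.
intros [-> | ->]; [now rewrite Rmult_1_l | ].
rewrite <- Rabs_Ropp; f_equal; ring.
Qed.

Lemma branch_converges (X Z TH : R -> R -> R) (e : R) :
  e = 1 \/ e = -1 -> profile_family X Z TH ->
  converges_on_compacts (at_right 0) (fun z0 => branch e (X z0) (Z z0)) (vertical_plane 0) /\
  single_sheeted (at_right 0) (fun z0 => branch e (X z0) (Z z0)).
Proof.
intros he fam; split.
- intros r eps r0 e0; destruct (thin_ascent r eps r0 e0) as [rho [hr thin]].
  apply at_right_0_intro with rho; [lra | intros z0 hz].
  assert (pr := fam z0 ltac:(lra)).
  destruct (profile_half_period z0 _ _ _ ltac:(lra) pr) as [s1 hp].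
  destruct (thin z0 _ _ _ s1 hz pr hp) as [lo_r [wide [high small]]].
  split.
  + intros p [b1 [b2 b3]] [s [t [s0 ->]]]; simpl in b1, b2, b3.
    rewrite sign_abs in b1 by exact he.
    assert (hs : 0 <= s <= s1).
      apply (branch_ascent z0 _ _ _ s1 r s pr hp wide s0).
      apply Rle_trans with (2 := b1), Rle_abs.
    specialize (small s hs ltac:(lra)).
    exists (V3 0 t (Z z0 s)); split.
      split; [reflexivity | exact (profile_pos _ _ _ _ s pr)].
    rewrite edist_horizontal, Rminus_0_r, sign_abs, Rabs_pos_eq; [lra | lra | exact he].
  + intros [q1 t zt] [b1 [b2 b3]] [q0 q3]; simpl in *; subst q1.
    destruct (ascent_reaches _ _ _ _ s1 zt pr hp) as [s [hs es]]; [lra | ].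
    specialize (small s hs ltac:(lra)).
    exists (V3 (e * X z0 s) t (Z z0 s)); split.
      exists s, t; split; [lra | reflexivity].
    rewrite es, edist_horizontal, Rminus_0_r, sign_abs, Rabs_pos_eq; [lra | lra | exact he].
- intros r r0; destruct (thin_ascent r 1 r0 Rlt_0_1) as [rho [hr thin]].
  apply at_right_0_intro with rho; [lra | intros z0 hz].
  assert (pr := fam z0 ltac:(lra)).
  destruct (profile_half_period z0 _ _ _ ltac:(lra) pr) as [s1 hp].
  destruct (thin z0 _ _ _ s1 hz pr hp) as [_ [wide _]].
  intros p q [bp _] [bq _] [s [t [s0 ->]]] [s' [t' [s0' ->]]]; simpl in *.
  intros -> ez.
  rewrite sign_abs in bp, bq by exact he.
  assert (hs : 0 <= s <= s1).
    apply (branch_ascent z0 _ _ _ s1 r s pr hp wide s0).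
    apply Rle_trans with (2 := bp), Rle_abs.
  assert (hs' : 0 <= s' <= s1).
    apply (branch_ascent z0 _ _ _ s1 r s' pr hp wide s0').
    apply Rle_trans with (2 := bq), Rle_abs.
  destruct (Rtotal_order s s') as [l | [-> | l]]; [exfalso | reflexivity | exfalso].
  + pose proof (profile_increasing _ _ _ _ _ s s' pr hp); lra.
  + pose proof (profile_increasing _ _ _ _ _ s' s pr hp); lra.
Qed.

Lemma at_right_0_imp (P Q : R -> Prop) :
  (forall y, 0 < y < 1 -> P y -> Q y) -> at_right 0 P -> at_right 0 Q.
Proof.
intros PQ [d hd]; apply at_right_0_intro with (Rmin d 1).
  apply Rmin_glb_lt; [apply cond_pos | lra].
pose proof (Rmin_l d 1); pose proof (Rmin_r d 1).
intros y hy; apply PQ; [lra | apply hd; [ | lra]].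
change (Rabs (y - 0) < d); rewrite Rminus_0_r, Rabs_pos_eq; lra.
Qed.

Lemma right_branch_iff (x z : R -> R) (p : vec3) :
  right_branch (complete_curve x z) p <-> branch 1 x z p.
Proof.
split.
- intros [s [t [_ [s0 ->]]]]; exists s, t; split; [exact s0 | ].
  unfold ruled; simpl; now rewrite Rmult_1_l.
- intros [s [t [s0 ->]]]; exists s, t; split; [split; exact I | split; [exact s0 | ]].
  unfold ruled; simpl; now rewrite Rmult_1_l.
Qed.

Lemma left_branch_iff (z0 : R) (x z th : R -> R) (p : vec3) : profile z0 x z th ->
  left_branch (complete_curve x z) p <-> branch (-1) x z p.
Proof.
intros pr; split.
- intros [s [t [_ [s0 ->]]]]; exists (- s), t; split; [lra | ].
  destruct (profile_even _ _ _ _ pr s) as [-> ->].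
  unfold ruled; simpl; f_equal; ring.
- intros [s [t [s0 ->]]]; exists (- s), t; split; [split; exact I | split; [lra | ]].
  unfold ruled; simpl; destruct (profile_even _ _ _ _ pr s) as [-> ->]; f_equal; ring.
Qed.

Lemma double_plane_ext (S S' : R -> vec3 -> Prop) (L : vec3 -> Prop) :
  (forall z0, 0 < z0 < 1 -> forall p, S' z0 p <-> S z0 p) ->
  converges_on_compacts (at_right 0) S L /\ single_sheeted (at_right 0) S ->
  converges_on_compacts (at_right 0) S' L /\ single_sheeted (at_right 0) S'.
Proof.
intros eq [cv ss]; split.
- intros r eps r0 e0; apply at_right_0_imp with (2 := cv r eps r0 e0).
  intros z0 hz [h1 h2]; split.
  + intros p bp Sp; apply h1; [exact bp | now apply eq].
  + intros q bq Lq; destruct (h2 q bq Lq) as [p [Sp d]]; exists p; split; [now apply eq | exact d].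
- intros r r0; apply at_right_0_imp with (2 := ss r r0).
  intros z0 hz h p q bp bq Sp Sq; apply h; trivial; now apply eq.
Qed.

Lemma converges_to_plane_as_z0_to_0 (X Z TH : R -> R -> R) : profile_family X Z TH ->
  converges_to_double_plane (at_right 0) (fun z0 => complete_curve (X z0) (Z z0)) 0.
Proof.
intros fam; split.
- apply double_plane_ext with (2 := branch_converges X Z TH 1 (or_introl eq_refl) fam).
  intros z0 hz p; apply right_branch_iff.
- apply double_plane_ext with (2 := branch_converges X Z TH (-1) (or_intror eq_refl) fam).
  intros z0 hz p; now apply (left_branch_iff z0 _ _ (TH z0)), fam.
Qed.

Lemma converges_to_horosphere_as_z0_to_1 (X Z TH : R -> R -> R) : profile_family X Z TH ->
  converges_on_compacts (at_left 1) (fun z0 => surface (complete_curve (X z0) (Z z0))) horosphere1.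
Proof.
intros fam r eps r0 e0.
destruct (potential_continuous_at_1 eps e0) as [rho [hr near]].
apply at_left_1_intro with (Rmin rho eps); [apply Rmin_glb_lt; lra | ].
pose proof (Rmin_l rho eps); pose proof (Rmin_r rho eps).
intros z0 hz; specialize (near z0 ltac:(lra)).
assert (hz' : 0 < z0 < 1) by lra.
assert (pr := fam z0 hz').
destruct (profile_half_period z0 _ _ _ hz' pr) as [s1 hp].
destruct (profile_top _ _ _ _ _ hz' pr hp) as [z1 [ep zb]].
assert (high : Z z0 s1 < 1 + eps) by (apply height_lt_of_potential; lra).
assert (close : forall s, Rabs (Z z0 s - 1) < eps).
  intros s; specialize (zb s); apply Rabs_def1; lra.
split.
- intros p _ [s [t [_ ->]]]; exists (V3 (X z0 s) t 1); split; [reflexivity | ].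
  unfold ruled; simpl; rewrite edist_vertical; apply close.
- intros [q1 t q3] _ e; unfold horosphere1 in e; simpl in e; subst q3.
  destruct (profile_inverse _ _ _ _ hz' pr) as [xi [_ [x_xi _]]].
  exists (V3 q1 t (Z z0 (xi q1))); split.
    exists (xi q1), t; split; [split; exact I | ].
    unfold ruled; simpl; now rewrite x_xi.
  rewrite edist_vertical; apply close.
Qed.

(** * Classification *)

Lemma dom_inhabited (g : curve) : Rbar_lt (lo g) (hi g) -> exists s, dom g s.
Proof.
unfold dom; destruct (lo g) as [l | | ], (hi g) as [h | | ]; simpl; intros lt; try contradiction.
- exists ((l + h) / 2); lra.
- exists (l + 1); split; [lra | exact I].
- exists (h - 1); split; [exact I | lra].
- exists 0; split; exact I.
Qed.

(** By uniqueness the given curve agrees with the reparametrized and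
    translated complete solution, which is a grim reaper extending it; maximality then
    makes the domain all of R. *)
Lemma maximal_matches_complete (g : curve) (x z c sg : R -> R) (e s0 s' : R) :
  e = 1 \/ e = -1 -> maximal_grim_reaper g -> dom g s0 ->
  (forall s, frame_at x z c sg s) ->
  cz g s0 = z s' -> tangent_x g s0 = e * c s' -> tangent_z g s0 = e * sg s' ->
  same_up_to_translation g (complete_curve x z).
Proof.
intros he [gr maxi] d0 fr ez ec eg.
set (sh := s' - e * s0); set (a := cx g s0 - x s').
assert (ee : e * e = 1) by (destruct he; subst e; ring).
assert (fr' := fun s => frame_symmetry x z c sg a e e sh s he he (fr (sh + e * s))).
assert (sh0 : sh + e * s0 = s') by (unfold sh; ring).
assert (eq : forall s, dom g s -> cz g s = z (sh + e * s) /\ cx g s = x (sh + e * s) + a).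
  intros s ds.
  destruct (frame_unique (dom g) _ _ _ _ _ _ _ _ s0 (dom_convex g) d0
    (fun t dt => grim_reaper_frame g t gr dt) (fun t _ => fr' t)) with (s := s)
    as [e1 [_ [_ e2]]]; simpl; rewrite ?sh0, ?Rplus_0_r; trivial.
  split; [exact e1 | ].
  simpl in e2; rewrite sh0, ee in e2; unfold a in *; lra.
assert (all : forall s, dom g s).
  intros s.
  apply (maxi _ (frame_grim_reaper _ _ _ _ fr')); [ | split; exact I].
  intros t dt; destruct (eq t dt) as [e1 e2]; split; [split; exact I | ].
  simpl; rewrite ee, e1, e2; split; ring.
exists a, sh, e; split; [exact he | intros s; split].
- split; intros _; [split; exact I | apply all].
- intros ds; destruct (eq s ds); now split.
Qed.

Lemma vertical_frame (s : R) : frame_at (fun _ => 0) exp (fun _ => 0) (fun _ => 1) s.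
Proof.
split; [apply exp_pos | split; [ring | unfold turning]].
split; [ | split; [ | split]].
- evar_last; [exact (is_derive_const (V := R_NormedModule) 0 s) | unfold zero; simpl; ring].
- evar_last; [apply is_derive_exp | ring].
- evar_last; [exact (is_derive_const (V := R_NormedModule) 0 s) | unfold zero; simpl; ring].
- evar_last; [exact (is_derive_const (V := R_NormedModule) 1 s) | unfold zero; simpl; ring].
Qed.

Lemma horizontal_frame (s : R) : frame_at (fun s => s) (fun _ => 1) (fun _ => 1) (fun _ => 0) s.
Proof.
split; [lra | split; [ring | unfold turning]].
split; [ | split; [ | split]].
- evar_last; [exact (is_derive_id s) | unfold one; simpl; ring].
- evar_last; [exact (is_derive_const (V := R_NormedModule) 1 s) | unfold zero; simpl; ring].
- evar_last; [exact (is_derive_const (V := R_NormedModule) 1 s) | unfold zero; simpl; ring].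
- evar_last; [exact (is_derive_const (V := R_NormedModule) 0 s) | unfold zero; simpl; field].
Qed.

Lemma vertical_maximal : maximal_grim_reaper vertical_line.
Proof. exact (complete_maximal _ _ (frame_grim_reaper _ _ _ _ vertical_frame)). Qed.

Lemma horizontal_maximal : maximal_grim_reaper horizontal_line.
Proof. exact (complete_maximal _ _ (frame_grim_reaper _ _ _ _ horizontal_frame)). Qed.

Lemma profile_maximal (z0 : R) (x z th : R -> R) :
  profile z0 x z th -> maximal_grim_reaper (complete_curve x z).
Proof.
intros pr; exact (complete_maximal _ _ (frame_grim_reaper _ _ _ _ (profile_frame _ _ _ _ pr))).
Qed.

Lemma vertical_surface (p : vec3) : surface vertical_line p <-> vertical_plane 0 p.
Proof.
split.
- intros [s [t [_ ->]]]; split; [reflexivity | apply exp_pos].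
- destruct p as [p1 p2 p3]; intros [e p0]; simpl in *; subst p1.
  exists (ln p3), p2; split; [split; exact I | ].
  unfold ruled; simpl; now rewrite exp_ln.
Qed.

Lemma horizontal_surface (p : vec3) : surface horizontal_line p <-> horosphere1 p.
Proof.
split.
- intros [s [t [_ ->]]]; reflexivity.
- destruct p as [p1 p2 p3]; intros e; unfold horosphere1 in e; simpl in *; subst p3.
  exists p1, p2; split; [split; exact I | reflexivity].
Qed.

Lemma vertical_totally_geodesic (s t : R) : totally_geodesic_at (ruled vertical_line) s t.
Proof.
assert (D0 : forall s, Derive (fun _ => 0) s = 0) by (intros; apply Derive_const).
assert (D1 : forall s, Derive exp s = exp s).
  intros r; apply is_derive_unique, is_derive_exp.
destruct (second_form_ruled vertical_line s t) as [j1 [j2 j3]].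
- apply exp_pos.
- simpl; rewrite D0, D1; ring.
- unfold totally_geodesic_at; rewrite j1, j2, j3; simpl.
  rewrite (Derive_ext _ _ s D0), D0.
  split; [ | split; [reflexivity | ]]; unfold Rdiv; ring.
Qed.

Lemma profile_generates (z0 : R) (x z th : R -> R) :
  profile z0 x z th -> generates_G z0 (complete_curve x z).
Proof.
intros pr; pose proof pr as [x0 [e0 [t0 sol]]].
exists th; split.
  split; [intros s _; apply sol | split; [split; exact I | now split]].
intros g' th' [sol' [d0 [x0' [e0' t0']]]].
assert (fr' : forall s, dom g' s ->
  frame_at (cx g') (cz g') (fun s => cos (th' s)) (fun s => sin (th' s)) s).
  intros s ds; destruct (sol' s ds) as [p [d1 [d2 d3]]]; now apply angle_frame.
assert (eq := frame_unique (dom g') _ _ _ _ _ _ _ _ 0 (dom_convex g') d0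
  (fun s _ => profile_frame _ _ _ _ pr s) fr').
simpl in eq; rewrite x0, e0, t0, x0', e0', t0' in eq.
specialize (eq eq_refl eq_refl eq_refl).
split.
- intros s ds; destruct (eq s ds) as [e1 [_ [_ e2]]].
  split; [split; exact I | simpl; split; lra].
- intros s ds.
  assert (h : th s - th' s = th 0 - th' 0); [ | lra].
  apply (convex_const (dom g') (fun s => th s - th' s)); [apply dom_convex | | exact d0 | exact ds].
  intros t dt; destruct (eq t dt) as [e1 [e2 _]].
  destruct (sol' t dt) as [_ [_ [_ d]]].
  evar_last.
    exact (is_derive_minus (V := R_NormedModule) _ _ _ _ _ (profile_dth _ _ _ _ t pr) d).
  rewrite e1, e2; apply Rminus_diag.
Qed.

Lemma sqr_eq_cases (a b : R) : a ^ 2 = b ^ 2 -> a = b \/ a = - b.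
Proof.
intros e; destruct (Req_dec (a - b) 0) as [h | h]; [left; lra | right].
assert ((a - b) * (a + b) = 0) by (simpl in e; lra).
apply Rmult_integral in H; lra.
Qed.

(** The height zt is attained on the ascent, where the first integral fixes
    the cosine and hence the sine up to sign; the reflected time has the opposite sine. *)
Lemma profile_passes (z0 : R) (x z th : R -> R) (zt c sg : R) :
  0 < z0 < 1 -> profile z0 x z th -> 0 < zt -> 0 < c -> c ^ 2 + sg ^ 2 = 1 ->
  potential z0 = potential zt - ln c / 2 ->
  exists s, z s = zt /\ cos (th s) = c /\ sin (th s) = sg.
Proof.
intros hz pr zt0 c0 u ez.
destruct (profile_half_period _ _ _ _ hz pr) as [s1 hp].
destruct (profile_top _ _ _ _ _ hz pr hp) as [z1 [ep _]].
assert (lc : ln c <= 0).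
  rewrite <- ln_1; apply Rcomplements.ln_le; [exact c0 | nra].
assert (between : z0 <= zt <= z s1).
  split.
  - destruct (Rle_or_lt z0 zt) as [l | l]; [exact l | ].
    pose proof (potential_decreasing zt z0); lra.
  - destruct (Rle_or_lt zt (z s1)) as [l | l]; [exact l | ].
    pose proof (potential_increasing (z s1) zt); lra.
destruct (ascent_reaches _ _ _ _ s1 zt pr hp between) as [s [hs es]].
assert (cosine : forall t, z t = zt -> cos (th t) = c).
  intros t et; rewrite (profile_cos _ _ _ _ t pr), et.
  replace (2 * (potential zt - potential z0)) with (ln c) by lra.
  now apply exp_ln.
destruct (sqr_eq_cases (sin (th s)) sg) as [e | e].
- pose proof (sin2_cos2 (th s)) as v; unfold Rsqr in v; rewrite (cosine s es) in v.
  simpl in *; lra.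
- exists s; split; [exact es | split; [now apply cosine | exact e]].
- (* The mirror point on the descending half. *)
  assert (st : sin (th 0) = 0) by (destruct pr as [_ [_ [-> _]]]; apply sin_0).
  destruct (profile_reflection _ _ _ _ 0 pr st s) as [e1 [e2 _]].
  exists (2 * 0 - s); rewrite e1, e2; split; [exact es | split; [ | lra]].
  apply cosine; now rewrite e1.
Qed.

(** The conserved value potential z - (ln |c|)/2 is at least 1, with equality
    only at the equilibrium; when it exceeds 1 it is the potential of a unique z0 < 1. *)
Lemma classification (g : curve) : maximal_grim_reaper g ->
  same_up_to_translation g vertical_line \/
  same_up_to_translation g horizontal_line \/
  exists z0, 0 < z0 < 1 /\ forall x z th, profile z0 x z th ->
    same_up_to_translation g (complete_curve x z).
Proof.
intros mg; pose proof mg as [gr _].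
destruct (dom_inhabited g (proj1 gr)) as [s0 d0].
destruct (grim_reaper_frame g s0 gr d0) as [zp [u _]].
set (c := tangent_x g s0) in *; set (sg := tangent_z g s0) in *.
destruct (Req_dec c 0) as [c0 | cn].
- left; destruct (sqr_eq_cases sg 1) as [e | e]; [rewrite c0 in u; simpl in *; lra | | ].
  + apply (maximal_matches_complete g _ _ _ _ 1 s0 (ln (cz g s0)) (or_introl eq_refl) mg d0
      vertical_frame); fold c sg; [now rewrite exp_ln | lra | lra].
  + apply (maximal_matches_complete g _ _ _ _ (-1) s0 (ln (cz g s0)) (or_intror eq_refl) mg d0
      vertical_frame); fold c sg; [now rewrite exp_ln | lra | lra].
- right.
  (* Reversing the curve if necessary, it runs in the positive x-direction. *)
  assert (dir : exists e k, (e = 1 \/ e = -1) /\ 0 < k /\ c = e * k).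
    destruct (Rtotal_order c 0) as [l | [l | l]]; [exists (-1), (- c) | contradiction | exists 1, c];
      split; try tauto; lra.
  destruct dir as [e [k [he [k0 ck]]]].
  assert (ee : e * e = 1) by (destruct he; subst e; ring).
  assert (uk : k ^ 2 + (e * sg) ^ 2 = 1).
    rewrite <- u, ck; transitivity (k ^ 2 + (e * e) * sg ^ 2); [ring | ].
    transitivity ((e * e) * k ^ 2 + sg ^ 2); [rewrite ee | ]; ring.
  assert (sge : sg = e * (e * sg)) by (rewrite <- Rmult_assoc, ee; ring).
  assert (lk : ln k <= 0).
    rewrite <- ln_1; apply Rcomplements.ln_le; [exact k0 | nra].
  pose proof (potential_min _ zp) as pm.
  destruct (Rle_lt_or_eq_dec 1 (potential (cz g s0) - ln k / 2)) as [lt | eq]; [lra | right | left].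
  + destruct (potential_onto_low _ lt) as [z0 [hz ez]].
    exists z0; split; [exact hz | intros x z th pr].
    destruct (profile_passes z0 x z th (cz g s0) k (e * sg) hz pr zp k0 uk ez) as [s' [e1 [e2 e3]]].
    apply (maximal_matches_complete g _ _ _ _ e s0 s' he mg d0 (profile_frame _ _ _ _ pr)).
    * now symmetry.
    * simpl; rewrite e2; exact ck.
    * simpl; rewrite e3; exact sge.
  + assert (z1 : cz g s0 = 1).
      destruct (Req_dec (cz g s0) 1) as [h | h]; [exact h | exfalso].
      pose proof (potential_gt_1 _ zp h); lra.
    assert (k1 : k = 1).
      apply ln_inv; [exact k0 | lra | rewrite ln_1; lra].
    apply (maximal_matches_complete g _ _ _ _ e s0 0 he mg d0 horizontal_frame); fold c sg.
    * exact z1.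
    * now rewrite ck, k1.
    * rewrite k1 in uk; rewrite sge; f_equal; nra.
Qed.

(** * Minimal and maximal heights *)

Lemma profile_min_height (z0 : R) (x z th : R -> R) :
  0 < z0 < 1 -> profile z0 x z th -> min_height (surface (complete_curve x z)) z0.
Proof.
intros hz pr.
destruct (profile_half_period _ _ _ _ hz pr) as [s1 hp].
destruct (profile_top _ _ _ _ _ hz pr hp) as [_ [_ zb]].
split.
- exists (V3 (x 0) 0 (z 0)); split; [ | now destruct pr as [_ [e _]]].
  exists 0, 0; split; [split; exact I | reflexivity].
- intros p [s [t [_ ->]]]; apply zb.
Qed.

Lemma profile_max_height (z0 h : R) (x z th : R -> R) :
  0 < z0 < 1 -> profile z0 x z th -> 1 < h -> potential h = potential z0 ->
  unique (fun h => 1 < h /\ max_height (surface (complete_curve x z)) h) h.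
Proof.
intros hz pr h1 eh.
destruct (profile_half_period _ _ _ _ hz pr) as [s1 hp].
destruct (profile_top _ _ _ _ _ hz pr hp) as [z1 [ep zb]].
assert (eq : z s1 = h) by (apply potential_inj_high; lra).
assert (top : surface (complete_curve x z) (V3 (x s1) 0 (z s1))).
  exists s1, 0; split; [split; exact I | reflexivity].
split.
- split; [exact h1 | split].
  + now exists (V3 (x s1) 0 (z s1)).
  + intros p [s [t [_ ->]]]; rewrite <- eq; apply zb.
- intros k [_ [[p [[s [t [_ ->]]] ek]] kb]].
  apply Rle_antisym.
  + rewrite <- eq; exact (kb _ top).
  + rewrite <- ek, <- eq; apply zb.
Qed.

(** The height above 1 at which the tangent is horizontal again. *)
Definition dual_height (zmax : R -> R) : Prop :=
  forall z0, 0 < z0 < 1 -> 1 < zmax z0 /\ potential (zmax z0) = potential z0.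

Lemma dual_height_bijective (zmax : R -> R) (h : R) : dual_height zmax -> 1 < h ->
  exists! z0, 0 < z0 < 1 /\ zmax z0 = h.
Proof.
intros dual h1.
destruct (potential_onto_low (potential h)) as [z0 [hz ez]]; [apply potential_gt_1; lra | ].
destruct (dual z0 hz) as [d1 d2].
exists z0; split.
- split; [exact hz | apply potential_inj_high; lra].
- intros y [hy ey]; destruct (dual y hy) as [_ d]; rewrite ey in d.
  apply potential_inj_low; lra.
Qed.

Lemma dual_height_at_0 (zmax : R -> R) : dual_height zmax ->
  filterlim zmax (at_right 0) (Rbar_locally p_infty).
Proof.
intros dual P [M hM].
destruct (potential_blowup (potential (Rmax 1 M))) as [rho [hr tall]].
apply at_right_0_intro with rho; [lra | intros z0 hz; apply hM].
destruct (dual z0 ltac:(lra)) as [d1 d2].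
apply Rle_lt_trans with (1 := Rmax_r 1 M).
apply height_lt_of_potential; [apply Rmax_l | lra | rewrite d2; now apply tall].
Qed.

Lemma dual_height_at_1 (zmax : R -> R) : dual_height zmax ->
  filterlim zmax (at_left 1) (locally 1).
Proof.
intros dual; apply filterlim_locally; intros eps.
destruct (potential_continuous_at_1 eps (cond_pos eps)) as [rho [hr near]].
apply at_left_1_intro with rho; [lra | intros z0 hz].
destruct (dual z0 ltac:(lra)) as [d1 d2].
pose proof (cond_pos eps).
assert (zmax z0 < 1 + eps).
  apply height_lt_of_potential; [lra | lra | rewrite d2; now apply near].
change (Rabs (zmax z0 - 1) < eps); apply Rabs_def1; lra.
Qed.

Lemma family_exists : exists X Z TH, profile_family X Z TH.
Proof.
assert (h : forall z0, exists f : (R -> R) * (R -> R) * (R -> R),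
  0 < z0 < 1 -> profile z0 (fst (fst f)) (snd (fst f)) (snd f)).
  intros z0; destruct (excluded_middle_informative (0 < z0 < 1)) as [hz | n].
  - destruct (profile_exists z0 hz) as [x [z [th pr]]]; now exists (x, z, th).
  - now exists (fun _ => 0, fun _ => 0, fun _ => 0).
set (F z0 := proj1_sig (constructive_indefinite_description _ (h z0))).
exists (fun z0 => fst (fst (F z0))), (fun z0 => snd (fst (F z0))), (fun z0 => snd (F z0)).
intros z0; exact (proj2_sig (constructive_indefinite_description _ (h z0))).
Qed.

Lemma dual_height_exists : exists zmax, dual_height zmax.
Proof.
assert (h : forall z0, exists k, 0 < z0 < 1 -> 1 < k /\ potential k = potential z0).
  intros z0; destruct (excluded_middle_informative (0 < z0 < 1)) as [hz | n].
  - destruct (potential_onto_high (potential z0)) as [k hk]; [apply potential_gt_1; lra | ].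
    now exists k.
  - now exists 0.
exists (fun z0 => proj1_sig (constructive_indefinite_description _ (h z0))).
intros z0; exact (proj2_sig (constructive_indefinite_description _ (h z0))).
Qed.

Theorem theorem3p5 :
  exists (G : R -> curve) (zmax : R -> R),
    (forall z0, 0 < z0 < 1 -> generates_G z0 (G z0)) /\
    (* every grim reaper belongs to one of the three families *)
    (forall g, maximal_grim_reaper g ->
       same_up_to_translation g vertical_line \/
       same_up_to_translation g horizontal_line \/
       exists z0, 0 < z0 < 1 /\ same_up_to_translation g (G z0)) /\
    (* vertical planes *)
    (maximal_grim_reaper vertical_line /\
     (forall p, surface vertical_line p <-> vertical_plane 0 p) /\
     (forall s t, totally_geodesic_at (ruled vertical_line) s t)) /\
    (* the horosphere z = 1 *)
    (maximal_grim_reaper horizontal_line /\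
     (forall p, surface horizontal_line p <-> horosphere1 p)) /\
    (* periodic entire graphs *)
    (forall z0, 0 < z0 < 1 ->
       maximal_grim_reaper (G z0) /\
       (exists u T, entire_graph (G z0) u /\ 0 < T /\ forall x, u (x + T) = u x) /\
       min_height (surface (G z0)) z0) /\
    (* limit z0 -> 0 *)
    (exists a, converges_to_double_plane (at_right 0) G a) /\
    (* limit z0 -> 1 *)
    converges_on_compacts (at_left 1) (fun z0 => surface (G z0)) horosphere1 /\
    (* maximal height *)
    (forall z0, 0 < z0 < 1 ->
       unique (fun h => 1 < h /\ max_height (surface (G z0)) h) (zmax z0)) /\
    (forall h, 1 < h -> exists! z0, 0 < z0 < 1 /\ zmax z0 = h) /\
    filterlim zmax (at_right 0) (Rbar_locally p_infty) /\
    filterlim zmax (at_left 1) (locally 1).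
Proof.
destruct family_exists as [X [Z [TH fam]]].
destruct dual_height_exists as [zmax dual].
exists (fun z0 => complete_curve (X z0) (Z z0)), zmax.
split; [ | split; [ | split; [ | split; [ | split; [ | split; [ | split;
  [ | split; [ | split; [ | split]]]]]]]]].
- intros z0 hz; exact (profile_generates _ _ _ _ (fam z0 hz)).
- intros g mg; destruct (classification g mg) as [v | [h | [z0 [hz eq]]]]; [tauto | tauto | ].
  right; right; exists z0; split; [exact hz | exact (eq _ _ _ (fam z0 hz))].
- split; [exact vertical_maximal | split].
    exact vertical_surface.
  exact vertical_totally_geodesic.
- split; [exact horizontal_maximal | exact horizontal_surface].
- intros z0 hz; split; [exact (profile_maximal _ _ _ _ (fam z0 hz)) | split].
    exact (profile_periodic_graph _ _ _ _ hz (fam z0 hz)).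
  exact (profile_min_height _ _ _ _ hz (fam z0 hz)).
- exists 0; exact (converges_to_plane_as_z0_to_0 X Z TH fam).
- exact (converges_to_horosphere_as_z0_to_1 X Z TH fam).
- intros z0 hz; destruct (dual z0 hz) as [d1 d2].
  exact (profile_max_height _ _ _ _ _ hz (fam z0 hz) d1 d2).
- intros h h1; exact (dual_height_bijective zmax h dual h1).
- exact (dual_height_at_0 zmax dual).
- exact (dual_height_at_1 zmax dual).
Qed.
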